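(* Let $D\subset\mathbb R^n$, $n\ge2$, be a domain, $q\ge1$, and let $f:D\to\mathbb R^n$ be differentiable a.e. in $D$, have the $N$- and $N^{-1}$-properties and property $L^{(2)}_q$. Then for every family $\Gamma$ of curves in $D$ and every $\rho\in\operatorname{adm}\Gamma$, $$M_q(f(\Gamma))\le\int_D K_{I,q}(x,f)\,\rho^q(x)\,dm(x).$$
   Context: $m$ is Lebesgue measure; mappings are continuous and orientation preserving. Curves are continuous maps of intervals; $f(\Gamma)=\{f\circ\gamma:\gamma\in\Gamma\}$. $\rho\in\operatorname{adm}\Gamma$ means $\rho:\mathbb R^n\to[0,\infty]$ Borel with $\int_\gamma\rho|dx|\ge1$ for all locally rectifiable $\gamma\in\Gamma$; $M_q(\Gamma)=\inf_{\rho\in\operatorname{adm}\Gamma}\int\rho^q\,dm$; ''$q$-a.e.'' means outside a subfamily of $q$-modulus zero. $N$-property: $m(f(S))=0$ whenever $m(S)=0$; $N^{-1}$-property: $m(f^{-1}(S))=0$ whenever $m(S)=0$. For locally rectifiable $\gamma$ with $f\circ\gamma$ locally rectifiable, $L_{\gamma,f}$ is the nondecreasing function with $L_{\gamma,f}(l_\gamma(t))=l_{f\circ\gamma}(t)$, $l_\gamma$ the signed length function. Property $L^{(2)}_q$: for $q$-a.e. curve $\tilde\gamma$ in $f(D)$, every curve $\gamma$ in $D$ with $f\circ\gamma=\tilde\gamma$ is locally rectifiable and $L_{\gamma,f}$ has the $N^{-1}$-property. At differentiability points, $l(f'(x))=\min_{|h|=1}|f'(x)h|$, $J(x,f)=\det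 f'(x)$, and $K_{I,q}(x,f)=|J(x,f)|/l(f'(x))^q$ if $J(x,f)\ne0$, $=1$ if $f'(x)=0$, $=\infty$ otherwise. *)

(* Defs.v *)
From HB Require Import structures.
From mathcomp Require Import all_boot all_order all_algebra.
From mathcomp Require Import all_classical all_reals all_analysis.
From mathcomp Require Import measurable_realfun matrix_topology matrix_normedtype.
Set Implicit Arguments. Unset Strict Implicit. Unset Printing Implicit Defensive.
Import Order.TTheory GRing.Theory Num.Theory.
Import numFieldNormedType.Exports.
Local Open Scope classical_set_scope.
Local Open Scope ring_scope.

Section Defs.
Variable R : realType.
Variable n : nat.
Local Notation V := 'rV[R]_n.

Definition enorm (v : V) : R := Num.sqrt (\sum_(i < n) (v 0 i) ^+ 2).

Definition box (a b : V) : set V :=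
  [set x | forall i, a 0 i <= x 0 i <= b 0 i].
Definition box_vol (a b : V) : R := \prod_(i < n) Num.max 0 (b 0 i - a 0 i).

Definition mstar (A : set V) : \bar R :=
  ereal_inf [set s | exists (a b : nat -> V),
     A `<=` \bigcup_k box (a k) (b k) /\
     s = (\sum_(k <oo) (box_vol (a k) (b k))%:E)%E].

Definition lmeasurable (A : set V) : Prop :=
  forall E, mstar E = (mstar (E `&` A) + mstar (E `&` ~` A))%E.

Definition mint (D : set V) (g : V -> \bar R) : \bar R :=
  ereal_sup [set s | exists (k : nat) (c : 'I_k -> R) (A : 'I_k -> set V),
     (forall i, 0 <= c i) /\ (forall i, lmeasurable (A i)) /\
     (forall i, A i `<=` D) /\
     (forall i j, i != j -> A i `&` A j = set0) /\
     (forall i x, A i x -> ((c i)%:E <= g x)%E) /\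
     s = (\sum_(i < k) ((c i)%:E * mstar (A i)))%E].

Definition borel_fun (rho : V -> \bar R) : Prop :=
  forall B : set (\bar R), measurable B ->
    <<s [set A : set V | open A] >> (rho @^-1` B).

Record curve := Curve { cI : interval R ; cf : R -> V }.

Definition is_curve (g : curve) : Prop := {within [set` cI g], continuous (cf g)}.

Definition curve_in (D : set V) (g : curve) : Prop :=
  is_curve g /\ forall t, t \in cI g -> D (cf g t).

Definition fcurve (f : V -> V) (g : curve) : curve := Curve (cI g) (f \o cf g).

Definition fam_image (f : V -> V) (G : set curve) : set curve := fcurve f @` G.

Definition len (g : R -> V) (a b : R) : \bar R :=
  ereal_sup [set s | exists (k : nat) (t : nat -> R),
     t 0%N = a /\ t k = b /\ (forall i, (i < k)%N -> t i <= t i.+1) /\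
     s = (\sum_(i < k) enorm (g (t i.+1) - g (t i)))%:E].

Definition loc_rect (g : curve) : Prop :=
  forall a b, a \in cI g -> b \in cI g -> a <= b -> (len (cf g) a b < +oo)%E.

(* arc-length parametrization of gamma|[a,b]: gamma0 (l_gamma(a,t)) = gamma t *)
Definition arclen_param (g : R -> V) (a b : R) (s : R) : V :=
  g (xget a [set t | a <= t <= b /\ fine (len g a t) = s]).

Definition lint_closed (rho : V -> \bar R) (g : R -> V) (a b : R) : \bar R :=
  let I : set R := [set` `[0, fine (len g a b)]] in
  (\int[lebesgue_measure]_(s in I) rho (arclen_param g a b s))%E.

Definition lint (rho : V -> \bar R) (g : curve) : \bar R :=
  ereal_sup [set s | exists a b, a \in cI g /\ b \in cI g /\ a <= b /\
                      s = lint_closed rho (cf g) a b].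

Definition adm (G : set curve) (rho : V -> \bar R) : Prop :=
  (forall x, (0 <= rho x)%E) /\ borel_fun rho /\
  forall g, G g -> loc_rect g -> (1 <= lint rho g)%E.

Definition modulus (q : R) (G : set curve) : \bar R :=
  ereal_inf [set s | exists rho, adm G rho /\
                      s = mint setT (fun x => (rho x `^ q)%E)].

Definition N_prop (D : set V) (f : V -> V) : Prop :=
  forall S, S `<=` D -> mstar S = 0%E -> mstar (f @` S) = 0%E.

Definition Ninv_prop (D : set V) (f : V -> V) : Prop :=
  forall S, mstar S = 0%E -> mstar (D `&` f @^-1` S) = 0%E.

Definition diff_ae (D : set V) (f : V -> V) : Prop :=
  mstar [set x | D x /\ ~ differentiable f x] = 0%E.

Definition slen (g : R -> V) (t0 t : R) : R :=
  if t0 <= t then fine (len g t0 t) else - fine (len g t t0).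

(* L_{gamma,f} (defined by L(l_gamma(t)) = l_{f o gamma}(t)) has the
   N^{-1}-property: L^{-1}(S) is null whenever S is null *)
Definition L_Ninv (f : V -> V) (g : curve) : Prop :=
  forall t0, t0 \in cI g ->
  forall S : set R, lebesgue_measure.-negligible S ->
    lebesgue_measure.-negligible
      [set s | exists t, t \in cI g /\ slen (cf g) t0 t = s /\
                         S (slen (f \o cf g) t0 t)].

Definition L2_prop (q : R) (D : set V) (f : V -> V) : Prop :=
  exists G0 : set curve, modulus q G0 = 0%E /\
  forall gt, curve_in (f @` D) gt -> ~ G0 gt ->
  forall g, curve_in D g -> fcurve f g = gt ->
    loc_rect g /\ (loc_rect (fcurve f g) -> L_Ninv f g).

Definition jac (f : V -> V) (x : V) : R := \det (lin1_mx ('d f x)).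

Definition lmin (f : V -> V) (x : V) : R :=
  inf [set enorm ('d f x h) | h in [set h : V | enorm h = 1]].

Definition KIq (q : R) (f : V -> V) (x : V) : \bar R :=
  if `[< differentiable f x >] then
    (if jac f x != 0 then (`|jac f x| / (lmin f x `^ q))%:E
     else if `[< forall h, 'd f x h = 0 >] then 1%E else +oo%E)
  else +oo%E.

Definition domain (D : set V) : Prop := open D /\ connected D /\ D !=set0.

End Defs.

(* Main.v *)
Require Import Defs.
From HB Require Import structures.
From mathcomp Require Import all_boot all_order all_algebra.
From mathcomp Require Import all_classical all_reals all_analysis.
From mathcomp Require Import measurable_realfun matrix_topology matrix_normedtype.
From mathcomp Require Import ring lra zify fingroup perm finmap.
Set Implicit Arguments. Unset Strict Implicit. Unset Printing Implicit Defensive.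
Import Order.TTheory GRing.Theory Num.Theory.
Import numFieldNormedType.Exports HBNNSimple.
Local Open Scope classical_set_scope.
Local Open Scope ring_scope.

(* Write Z for the exceptional set where f is not differentiable, J = 0, or rho is
   infinite. It is null if the right-hand side is finite: f({J = 0}) is null, hence
   so is {J = 0} by the N^{-1}-property. Off Z one pushes rho / l(f') forward by f. Only upper bounds of
   volumes of images are needed: for a matrix U, if x |-> f x U is c-Lipschitz for
   the sup norm on S, then m(f(S)) <= c^n / |det U| m(S); letting (U, c) run over
   countably many rational choices this gives m(f(S)) <= M m(S) as soon as
   |J| < M on S, singular derivatives included. Cutting the domain into Borel
   pieces A_k on which rho, |J| and l(f') are constant up to a factor t > 1 and
   enlarging f(A_k) to a Borel set of the same measure, no measurability of images
   and no injectivity is required, and the pieces compute the lower integral on the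
   right-hand side up to a power of t.
   For admissibility, let gamma have length function u, and f o gamma length
   function w. If f expands distances by c near gamma(S), then a near-optimal
   partition shows that the part of f o gamma over S has length at least c times
   that of gamma over S; this replaces differentiability of the arc-length
   parametrization. The N^{-1}-property of L makes u a function of w and controls
   the part of gamma inside Z, where the new density is infinite along f o gamma. *)

(** * Lebesgue outer measure *)

(** The two sides are treated asymmetrically. The right-hand side is a lower integral, so each
    finite family of disjoint measurable pieces bounds it from below, and [KIq] is only ever
    compared with constants on such pieces; the left-hand side is bounded by integrating a single
    Borel density. The obstacle is that sets cut out by the derivative are not visibly Borel. They
    are replaced by two-point conditions on f over rational balls with rational parameters:
    continuity makes these Borel, and they agree with the derivative conditions at every point of D
    where f is differentiable. The same two-point form is what the length estimate along curves
    uses, so no chain rule along a curve occurs. The N-property enters at one place: f(D [&] Z) is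
    null, so a density that is infinite on a Borel null set containing it costs nothing. The final
    constant t^(2q+1) collects t^q from rho, t^q from l(f') and t from |J|; then t tends to 1. *)

Section outer_measure.
Variables (R : realType) (n : nat).
Local Notation V := 'rV[R]_n.+1.
Implicit Types (A B : set V) (a b : V).

Lemma box_vol_ge0 a b : 0 <= box_vol a b.
Proof. by apply: prodr_ge0 => i _; rewrite le_max lexx. Qed.

Lemma box_vol0 : box_vol (0 : V) 0 = 0.
Proof.
by rewrite /box_vol (bigD1 ord0) //= mxE subrr maxxx mul0r.
Qed.

Lemma mstar_ge0 A : (0 <= mstar A)%E.
Proof.
apply: le_ereal_inf_tmp => _ [a [b [_ ->]]].
by apply: nneseries_ge0 => k _ _; rewrite lee_fin box_vol_ge0.
Qed.

Lemma mstar_sum_box A (a b : nat -> V) :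
  A `<=` \bigcup_k box (a k) (b k) ->
  (mstar A <= \sum_(k <oo) (box_vol (a k) (b k))%:E)%E.
Proof. by move=> Aab; apply: ereal_inf_lbound; exists a, b. Qed.

Lemma mstar_box a b : (mstar (box a b) <= (box_vol a b)%:E)%E.
Proof.
pose a' k : V := if k is 0%N then a else 0.
pose b' k : V := if k is 0%N then b else 0.
apply: (le_trans (mstar_sum_box (a := a') (b := b') _)).
  by move=> x xab; exists 0%N.
rewrite (nneseries_split 0%N 1) ?add0n//; last first.
  by move=> k _; rewrite lee_fin box_vol_ge0.
rewrite big_nat1 eseries0 ?adde0// => -[|k]//= _ _.
by rewrite box_vol0.
Qed.

Lemma mstar0 : mstar (set0 : set V) = 0%E.
Proof.
apply/eqP; rewrite eq_le mstar_ge0 andbT.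
apply: (le_trans (mstar_sum_box (a := fun=> 0) (b := fun=> 0) _)) => //.
by rewrite eseries0// => k _ _; rewrite box_vol0.
Qed.

Lemma mstar_near_cover A (e : R) : 0 < e -> (mstar A < +oo)%E ->
  exists a b : nat -> V, A `<=` \bigcup_k box (a k) (b k) /\
    (\sum_(k <oo) (box_vol (a k) (b k))%:E <= mstar A + e%:E)%E.
Proof.
move=> e0 Aoo.
have Afin : mstar A \is a fin_num by rewrite ge0_fin_numE ?mstar_ge0.
have [_ [a [b [Aab ->]]] lte] := lb_ereal_inf_adherent e0 Afin.
by exists a, b; split=> //; exact: ltW.
Qed.

Lemma le_mstar A B : A `<=` B -> (mstar A <= mstar B)%E.
Proof.
move=> AB; apply: le_ereal_inf_tmp => _ [a [b [Bab ->]]].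
by apply: mstar_sum_box; exact: subset_trans Bab.
Qed.

(** Near-optimal covers of the [A k], with excess e / 2^(k+1), are merged into one sequence of boxes
    through a bijection of [nat] with [nat * nat]. *)
Lemma mstar_sigma_subadditive : sigma_subadditive (@mstar R n.+1).
Proof.
move=> A; have [[i ioo]|] := pselect (exists i, mstar (A i) = +oo%E).
  rewrite (eseries_pinfty _ _ ioo) ?leey// => k _.
  by rewrite -ltNye (lt_le_trans _ (mstar_ge0 _)).
rewrite -forallNE => Aoo.
apply/lee_addgt0Pr => e e0.
rewrite (le_trans _ (epsilon_trick _ _ (ltW e0)))//; last first.
  by move=> k; exact: mstar_ge0.
pose P k (G : nat -> V * V) := A k `<=` \bigcup_m box (G m).1 (G m).2 /\
  (\sum_(m <oo) (box_vol (G m).1 (G m).2)%:E <=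
   mstar (A k) + (e / (2 ^ k.+1)%:R)%:E)%E.
have [G PG] : {G : (nat -> V * V)^nat & forall k, P k (G k)}.
  apply: (@choice _ _ P) => k.
  have [||a [b [Aab ab]]] := @mstar_near_cover (A k) (e / (2 ^ k.+1)%:R).
  - by rewrite divr_gt0// ltr0n expn_gt0.
  - by rewrite ltey; apply/eqP; exact: Aoo.
  by exists (fun m => (a m, b m)).
pose vol (ab : V * V) : \bar R := (box_vol ab.1 ab.2)%:E.
have vol0 ab : (0 <= vol ab)%E by rewrite lee_fin box_vol_ge0.
have /card_esym/ppcard_eqP[h] := card_nat2.
apply: (@le_trans _ _ (\sum_(k <oo) vol (uncurry G (h k)))%E).
  apply: (mstar_sum_box (a := fun k => (uncurry G (h k)).1)
                        (b := fun k => (uncurry G (h k)).2)).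
  move=> x [k _] /(PG k).1[m _ xkm]; exists (h^-1%FUN (k, m)) => //=.
  by rewrite invK//; exact: mem_set.
rewrite nneseries_esumT//.
have hbij : set_bij [set: nat] [set: nat * nat] h.
  split => [x _ //|x y _ _ hxy|[x y] _].
    by apply: (@inj _ _ _ h) => //; exact: mem_set.
  by exists (h^-1%FUN (x, y)) => //; rewrite invK//; exact: mem_set.
rewrite -(@reindex_esum _ _ _ _ _ _ (vol \o uncurry G) hbij).
have -> : \esum_(k in [set: nat * nat]) (vol \o uncurry G) k =
    \esum_(i in [set: nat]) \esum_(j in [set: nat]) vol (G i j).
  rewrite esum_esum//.
  rewrite (_ : [set: nat] `*`` _ = [set: nat * nat]); last first.
    by apply/seteqP; split=> [[]|[]].
  by apply: eq_esum => -[].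
rewrite nneseries_esumT; last first.
  by move=> k; apply: adde_ge0; [exact: mstar_ge0|rewrite lee_fin divr_ge0// ltW].
apply: le_esum => k _; rewrite -nneseries_esumT//.
exact: (PG k).2.
Qed.

HB.instance Definition _ := isOuterMeasure.Build R V (@mstar R n.+1)
  mstar0 mstar_ge0 le_mstar mstar_sigma_subadditive.

End outer_measure.

(** * Borel sets are Caratheodory measurable for [mstar] *)

Section borel_lmeasurable.
Variables (R : realType) (n : nat).
Local Notation V := 'rV[R]_n.+1.
Implicit Types (A B : set V).

Let mu : {outer_measure set V -> \bar R} := @mstar R n.+1.

(** Cutting each box of a cover along the hyperplane x_i = c splits its volume exactly, so a cover
    of X yields covers of both parts with the same total. *)
Lemma lmeasurable_halfspace (i : 'I_n.+1) (c : R) :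
  lmeasurable [set x : V | x 0 i <= c].
Proof.
apply: (@le_caratheodory_measurable _ _ mu) => X.
apply: le_ereal_inf_tmp => _ [a [b [Xab ->]]].
(* If the hyperplane misses the box, one of the two pieces has a side of nonpositive length; the
   [max] in [box_vol] gives it volume 0. *)
pose b' k : V := \row_j if j == i then Num.min (b k 0 j) c else b k 0 j.
pose a' k : V := \row_j if j == i then Num.max (a k 0 j) c else a k 0 j.
have -> : (\sum_(k <oo) (box_vol (a k) (b k))%:E =
    \sum_(k <oo) (box_vol (a k) (b' k))%:E +
    \sum_(k <oo) (box_vol (a' k) (b k))%:E)%E.
  rewrite -nneseriesD; [|by move=> k _ _; rewrite lee_fin box_vol_ge0..].
  apply: eq_eseriesr => k _; rewrite -EFinD; congr _%:E.
  rewrite /box_vol !(bigD1 i (P := xpredT))//= !mxE eqxx.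
  rewrite [in X in _ = X + _](eq_bigr (fun j => Num.max 0 (b k 0 j - a k 0 j))); last first.
    by move=> j ji; rewrite !mxE (negbTE ji).
  rewrite [in X in _ = _ + X](eq_bigr (fun j => Num.max 0 (b k 0 j - a k 0 j))); last first.
    by move=> j ji; rewrite !mxE (negbTE ji).
  rewrite -mulrDl; congr (_ * _); move: (a k 0 i) (b k 0 i) => p r.
  rewrite /Num.max /Num.min.
  by repeat case: ifP => //=; lra.
apply: leeD; apply: mstar_sum_box => x [/Xab[k _ xab]] /= xc; exists k => // j.
  rewrite mxE; case: eqP => [->|_]; last exact: xab.
  by rewrite le_min xc andbT; exact: xab.
rewrite mxE; case: eqP => [->|_]; last exact: xab.
move/negP: xc; rewrite -ltNge => /ltW xc.
by rewrite ge_max xc andbT; exact: xab.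
Qed.

Lemma lmeasurable_box (a b : V) : lmeasurable (box a b).
Proof.
have -> : box a b = \bigcap_(i in [set: 'I_n.+1])
    ([set x : V | a 0 i <= x 0 i] `&` [set x | x 0 i <= b 0 i]).
  apply/seteqP; split=> [x xab i _|x xab i].
    by have /andP[] := xab i.
  by apply/andP; have [] := xab i I.
apply: (@fin_bigcap_measurable _ (caratheodory_type mu)) => // i _.
apply: (@measurableI _ (caratheodory_type mu)); last exact: lmeasurable_halfspace.
have -> : [set x : V | a 0 i <= x 0 i] =
    \bigcap_k ~` [set x : V | x 0 i <= a 0 i - k.+1%:R^-1].
  apply/seteqP; split=> [x /= ax k _ /=|x xk /=].
    by apply/negP; rewrite -ltNge (lt_le_trans _ ax)// ltrBlDr ltrDl invr_gt0 ltr0n.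
  rewrite leNgt; apply/negP => xa.
  have [k ka] := ltr_add_invr xa.
  by apply: (xk k I) => /=; rewrite lerBrDr ltW.
apply: (@bigcap_measurable _ (caratheodory_type mu)) => // k _.
by apply: (@measurableC _ (caratheodory_type mu)); exact: lmeasurable_halfspace.
Qed.

Definition rat_box (ab : 'rV[rat]_n.+1 * 'rV[rat]_n.+1) : set V :=
  box (map_mx ratr ab.1) (map_mx ratr ab.2).

Lemma open_bigcup_rat_box (U : set V) : open U ->
  U = \bigcup_(ab in [set ab | rat_box ab `<=` U]) rat_box ab.
Proof.
move=> oU; apply/seteqP; split=> [x Ux|x [ab /= abU] /abU//].
have [e /= e0 eU] : nbhs_ball x U by rewrite nbhs_ballE; exact: open_nbhs_nbhs.
have aP i : exists q : rat, x 0 i - e < ratr q < x 0 i.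
  have [|q] := @rat_in_itvoo R (x 0 i - e) (x 0 i); first by rewrite ltrBlDr ltrDl.
  by rewrite in_itv; exists q.
have bP i : exists q : rat, x 0 i < ratr q < x 0 i + e.
  have [|q] := @rat_in_itvoo R (x 0 i) (x 0 i + e); first by rewrite ltrDl.
  by rewrite in_itv; exists q.
have [a {}aP] := choice aP; have [b {}bP] := choice bP.
exists (\row_i a i, \row_i b i); last first.
  move=> i; rewrite !mxE; have /andP[_ /ltW ->] := aP i.
  by have /andP[/ltW -> _] := bP i.
move=> y yab; apply: eU; split=> // i j; rewrite ord1.
have := yab j; rewrite !mxE => /andP[ay yb].
have /andP[ax _] := aP j; have /andP[_ xb] := bP j.
rewrite /ball/= ltr_norml; lra.
Qed.

Lemma borel_lmeasurable (A : set V) : <<s [set U | open U] >> A -> lmeasurable A.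
Proof.
move=> sA; suff : <<s [set U : set V | open U] >> `<=` mu.-cara.-measurable.
  by move/(_ _ sA).
apply: smallest_sub.
  by apply: (@sigma_algebra_measurable _ (caratheodory_type mu)).
move=> U /= oU; rewrite (open_bigcup_rat_box oU).
rewrite bigcup_mkcond; apply: (@countable_bigcupT_measurable _ (caratheodory_type mu)).
  by apply: countableP.
by move=> ab; case: ifP => _; [exact: lmeasurable_box|exact: measurable0].
Qed.

End borel_lmeasurable.

(** Limit passage r -> 0 for bounds with an error polynomial in r: the overhang of a grid and the
    off-diagonal part of a triangular matrix both have this form. *)
Lemma horner0_ge (R : realType) (p : {poly R}) (m : \bar R) :
  (forall r, 0 < r -> (m <= p.[r]%:E)%E) -> (m <= p.[0]%:E)%E.
Proof.
move=> mp; case: m mp => [m||] mp; last by rewrite leNye.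
- rewrite lee_fin leNgt; apply/negP => p0m.
  have : nbhs (0 : R) [set r | p.[r] < m].
    have /(_ 0) := @continuous_horner R p.
    by move/cvgr_lt; apply.
  rewrite -nbhs_ballE => -[e /= e0 /(_ (e / 2))].
  have e20 : 0 < e / 2 by rewrite divr_gt0.
  rewrite /ball/= sub0r normrN gtr0_norm// ltr_pdivrMr// mulr2n mulrDr mulr1 ltrDl.
  by move=> /(_ e0); rewrite ltNge -lee_fin mp.
- by have := mp 1 ltr01.
Qed.

Section row_norm.
Variables (R : realType) (n : nat).
Implicit Types (x : 'rV[R]_n.+1) (c : R).

Lemma le_coord_norm x i : `|x 0 i| <= `|x|.
Proof.
rewrite -[leRHS]/(mx_norm x) mx_normrE.
exact: (le_bigmax _ (fun ij : 'I_1 * 'I_n.+1 => `|x ij.1 ij.2|) (0, i)).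
Qed.

Lemma norm_le_coord x c : (forall i, `|x 0 i| <= c) -> `|x| <= c.
Proof.
move=> xc; rewrite -[leLHS]/(mx_norm x) mx_normrE; apply: bigmax_le => [|[i j] _].
  exact: le_trans (xc ord0).
by rewrite (ord1 i).
Qed.

End row_norm.

(** * Outer measure of images under Lipschitz and linear maps *)

Section linear_images.
Variables (R : realType) (n : nat).
Local Notation V := 'rV[R]_n.+1.
Implicit Types (A B : set V) (a b : V).

Lemma mstar_bigcup_fin (T : finType) (F : T -> set V) :
  (mstar (\bigcup_i F i) <= \sum_(i : T) mstar (F i))%E.
Proof.
have -> : \bigcup_i F i = \big[setU/set0]_(i : T) F i.
  rewrite -big_enum -bigcup_seq; apply: eq_bigcupl.
  by split=> i // _ /=; rewrite mem_enum.
elim/big_rec2: _ => [|i x y _ xy]; first by rewrite mstar0.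
apply: (le_trans (outer_measureU2 (@mstar R n.+1) _ _)).
exact: leeD2l.
Qed.

(** Only boxes of one shape e, at all scales r, have to be controlled: any box is tiled by them up
    to an overhang that vanishes with r. The shape is left free so that triangular matrices can be
    treated with very thin boxes. *)
Lemma mstar_image_grid (phi : V -> V) A (e : V) (kappa : R) :
  (forall i, 0 < e 0 i) -> 0 <= kappa ->
  (forall r c, 0 < r ->
    (mstar (phi @` (A `&` box c (c + r *: e))) <=
      (kappa * \prod_(i < n.+1) (r * e 0 i))%:E)%E) ->
  (mstar (phi @` A) <= kappa%:E * mstar A)%E.
Proof.
move=> e0 k0 H.
have Hbox a b : (mstar (phi @` (A `&` box a b)) <= (kappa * box_vol a b)%:E)%E.
  have [ab|nab] := pselect (forall i, a 0 i <= b 0 i); last first.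
    rewrite (_ : _ @` _ = set0) ?mstar0 ?lee_fin ?mulr_ge0 ?box_vol_ge0//.
    rewrite -subset0 => y /= [x [_ xab] _]; apply: nab => i.
    by have /andP[h1 h2] := xab i; exact: le_trans h1 h2.
  (* [kappa] times the volume of the box with every side lengthened by one cell; the value at 0 is
     the bound sought. *)
  pose p : {poly R} := kappa *: \prod_(i < n.+1) ((b 0 i - a 0 i)%:P + e 0 i *: 'X).
  have pE r : p.[r] = kappa * \prod_(i < n.+1) (b 0 i - a 0 i + r * e 0 i).
    rewrite hornerZ horner_prod; congr (_ * _); apply: eq_bigr => i _.
    by rewrite hornerD hornerC hornerZ hornerX mulrC.
  have -> : kappa * box_vol a b = p.[0].
    rewrite pE; congr (_ * _); apply: eq_bigr => i _; rewrite mul0r addr0.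
    by apply/max_idPr; rewrite subr_ge0.
  apply: horner0_ge => r r0; rewrite pE.
  have re0 i : 0 < r * e 0 i by rewrite mulr_gt0.
  (* At most one cell too many in each direction, which is the extra r e_i in [p]. *)
  pose N i := (Num.truncn ((b 0 i - a 0 i) / (r * e 0 i))).+1.
  pose c (g : {dffun forall i : 'I_n.+1, 'I_(N i)}) : V :=
    \row_i (a 0 i + (r * e 0 i) * (g i)%:R).
  apply: (@le_trans _ _ (mstar
      (\bigcup_g phi @` (A `&` box (c g) (c g + r *: e))))).
    apply: le_mstar => _ [x [Ax xab] <-].
    have xN (i : 'I_n.+1) : (Num.truncn ((x 0 i - a 0 i) / (r * e 0 i))%R < N i)%N.
      rewrite ltnS; apply: le_truncn.
      rewrite ler_pM2r ?invr_gt0// lerD2r.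
      by have /andP[] := xab i.
    exists [ffun i => Ordinal (xN i)] => //.
    exists x => //; split=> // i; rewrite !mxE ffunE/=.
    have /andP[xa _] := xab i.
    have /truncn_itv : 0 <= (x 0 i - a 0 i) / (r * e 0 i).
      by rewrite divr_ge0// ?subr_ge0// ltW.
    move=> /andP[]; rewrite ler_pdivlMr// ltr_pdivrMr// -natr1 => h1 h2.
    by apply/andP; split; lra.
  apply: (le_trans (mstar_bigcup_fin _)).
  apply: (@le_trans _ _ (\sum_(g : {dffun forall i : 'I_n.+1, 'I_(N i)})
     (kappa * \prod_(i < n.+1) (r * e 0 i))%:E)%E).
    by apply: lee_sum => g _; exact: H.
  rewrite sumEFin lee_fin sumr_const card_dep_ffun.
  rewrite -mulrnAr ler_wpM2l//.
  rewrite foldrE big_map big_enum/= -mulr_natl natr_prod -big_split/=.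
  apply: ler_prod => i _; apply/andP; split; first by rewrite mulr_ge0// ltW.
  rewrite /= card_ord /N -natr1 [(_ + 1) * _]mulrDl mul1r.
  rewrite lerD2r -ler_pdivlMr// truncn_le divr_ge0 ?subr_ge0//.
  by rewrite ltW.
have Hcover (a b : nat -> V) : A `<=` \bigcup_k box (a k) (b k) ->
    (mstar (phi @` A) <= \sum_(k <oo) (kappa * box_vol (a k) (b k))%:E)%E.
  move=> Aab; apply: (@le_trans _ _
      (mstar (\bigcup_k phi @` (A `&` box (a k) (b k))))).
    by apply: le_mstar => _ [x Ax <-]; have [k _ xk] := Aab _ Ax; exists k => //; exists x.
  apply: (le_trans (mstar_sigma_subadditive _)).
  by apply: lee_nneseries => [k _ _|k _]; [exact: mstar_ge0|exact: Hbox].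
have [Aoo|Aoo] := eqVneq (mstar A) +oo%E.
  have [k00|k1] := eqVneq kappa 0; last first.
    by rewrite Aoo gt0_muley ?leey// lte_fin lt0r k1.
  (* Here [kappa = 0] and 0 times +oo is 0, so the image must be shown null: the cubes [-k, k]^(n+1)
     cover everything and each contributes 0. *)
  have := Hcover (fun k => const_mx (- k%:R)) (fun k => const_mx k%:R).
  rewrite k00 mul0e eseries0 => [|k _ _]; last by rewrite mul0r.
  apply => x _; have [k xk] : exists k : nat, forall i, `|x 0 i| <= k%:R.
    exists (Num.truncn (\sum_i `|x 0 i|)).+1 => i.
    apply: ltW; apply: le_lt_trans (truncnS_gt _).
    by rewrite (bigD1 i)//= lerDl sumr_ge0.
  by exists k => // i; rewrite !mxE -ler_norml.
have [k0'|k0'] := eqVneq kappa 0.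
  have {}Aoo : (mstar A < +oo)%E by rewrite ltey.
  have [a [b [Aab _]]] := mstar_near_cover ltr01 Aoo.
  have := Hcover _ _ Aab; rewrite k0' mul0e eseries0 => [//|k _ _].
  by rewrite mul0r.
apply/lee_addgt0Pr => eps eps0.
have {}Aoo : (mstar A < +oo)%E by rewrite ltey.
have kgt0 : 0 < kappa by rewrite lt0r k0' k0.
have [||a [b [Aab sab]]] := @mstar_near_cover _ _ A (eps / kappa).
- by rewrite divr_gt0.
- by [].
apply: (le_trans (Hcover _ _ Aab)).
under eq_eseriesr do rewrite EFinM.
rewrite nneseriesZl//; last by move=> k _; rewrite lee_fin box_vol_ge0.
apply: (@le_trans _ _ (kappa%:E * (mstar A + (eps / kappa)%:E))%E).
  by apply: lee_wpmul2l => //; rewrite lee_fin.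
rewrite ge0_muleDr ?mstar_ge0//; last by rewrite lee_fin divr_ge0 ?ltW.
by rewrite -EFinM mulrCA divff ?mulr1.
Qed.

Lemma box_translate (c e x y : V) (i : 'I_n.+1) : box c (c + e) x ->
  box c (c + e) y -> `|x 0 i - y 0 i| <= e 0 i.
Proof.
move=> /(_ i)/andP[cx xc] /(_ i)/andP[cy yc]; move: xc yc; rewrite !mxE => xc yc.
by rewrite ler_norml; apply/andP; split; lra.
Qed.

Lemma mstar_diam A (d : V) : (forall i, 0 <= d 0 i) ->
  (forall x y i, A x -> A y -> `|x 0 i - y 0 i| <= d 0 i) ->
  (mstar A <= (\prod_(i < n.+1) d 0 i)%:E)%E.
Proof.
move=> d0 Ad; have [->|/set0P[z Az]] := eqVneq A set0.
  by rewrite mstar0 lee_fin prodr_ge0.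
pose lo i := inf [set x 0 i | x in A].
have hlo i : has_inf [set (x : V) 0 i | x in A].
  split; first by exists (z 0 i), z.
  exists (z 0 i - d 0 i) => _ [x Ax <-].
  by have := Ad z x i Az Ax; rewrite ler_norml => /andP[_]; lra.
pose a : V := \row_i lo i.
apply: (@le_trans _ _ (mstar (box a (a + d)))).
  apply: le_mstar => x Ax i; rewrite !mxE; apply/andP; split.
    by apply: ge_inf; [exact: (hlo i).2|exists x].
  rewrite -lerBlDr; apply: lb_le_inf; first by exists (z 0 i), z.
  by move=> _ [y Ay <-]; have := Ad x y i Ax Ay; rewrite ler_norml => /andP[_]; lra.
apply: (le_trans (mstar_box _ _)); rewrite lee_fin.
rewrite /box_vol le_eqVlt; apply/orP; left; apply/eqP; apply: eq_bigr => i _.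
by rewrite !mxE addrAC subrr add0r; apply/max_idPr.
Qed.

Lemma mstar_image_coord_lipschitz (phi : V -> V) A (e d : V) :
  (forall i, 0 < e 0 i) -> (forall i, 0 <= d 0 i) ->
  (forall r x y, 0 < r -> A x -> A y ->
    (forall i, `|x 0 i - y 0 i| <= r * e 0 i) ->
    forall j, `|phi x 0 j - phi y 0 j| <= r * d 0 j) ->
  (mstar (phi @` A) <= (\prod_(i < n.+1) (d 0 i / e 0 i))%:E * mstar A)%E.
Proof.
move=> e0 d0 H; apply: (mstar_image_grid e0).
  by apply: prodr_ge0 => i _; rewrite divr_ge0// ltW.
move=> r c r0; rewrite -big_split/=.
rewrite (eq_bigr (fun i => (r *: d) 0 i)); last first.
  by move=> i _; rewrite mxE mulrCA divfK// gt_eqF.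
apply: mstar_diam => [i|_ _ j [x [Ax xc] <-] [y [Ay yc] <-]].
  by rewrite mxE mulr_ge0// ltW.
rewrite mxE; apply: H => // i.
by have := box_translate i xc yc; rewrite mxE.
Qed.

Lemma mstar_image_lipschitz (phi : V -> V) A (c : R) : 0 <= c ->
  (forall x y, A x -> A y -> `|phi x - phi y| <= c * `|x - y|) ->
  (mstar (phi @` A) <= (c ^+ n.+1)%:E * mstar A)%E.
Proof.
move=> c0 H.
have -> : c ^+ n.+1 = \prod_(i < n.+1) ((const_mx c : V) 0 i / (const_mx 1 : V) 0 i).
  rewrite (eq_bigr (fun=> c)) => [|i _]; last by rewrite !mxE divr1.
  by rewrite prodr_const card_ord.
apply: mstar_image_coord_lipschitz => [i|i|r x y r0 Ax Ay xy j]; rewrite ?mxE//.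
have xyr : `|x - y| <= r.
  by apply: norm_le_coord => i; have := xy i; rewrite !mxE mulr1.
have := le_coord_norm (phi x - phi y) j; rewrite !mxE => /le_trans; apply.
by rewrite (le_trans (H x y Ax Ay))// mulrC ler_wpM2r.
Qed.

Lemma mstar_mulmx_le (W : 'M[R]_n.+1) A (e : V) : (forall i, 0 < e 0 i) ->
  (mstar ((mulmx^~ W) @` A) <=
   (\prod_(j < n.+1) ((\sum_(i < n.+1) e 0 i * `|W i j|) / e 0 j))%:E * mstar A)%E.
Proof.
move=> e0.
pose d : V := \row_j \sum_(i < n.+1) e 0 i * `|W i j|.
rewrite (eq_bigr (fun j => d 0 j / e 0 j)); last by move=> j _; rewrite mxE.
apply: mstar_image_coord_lipschitz => // [j|r x y r0 Ax Ay xy j].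
  by rewrite mxE sumr_ge0// => i _; rewrite mulr_ge0// ltW.
rewrite !mxE -sumrB mulr_sumr (le_trans (ler_norm_sum _ _ _))// ler_sum// => i _.
by rewrite -mulrBl normrM mulrA ler_wpM2r.
Qed.

Lemma mstar_mulmx_perm (W : 'M[R]_n.+1) A : is_perm_mx W ->
  (mstar ((mulmx^~ W) @` A) <= mstar A)%E.
Proof.
move=> /is_perm_mxP[s ->].
have e0 (i : 'I_n.+1) : 0 < (const_mx 1 : V) 0 i by rewrite mxE.
apply: (le_trans (mstar_mulmx_le _ _ e0)).
rewrite big1 ?mul1e// => j _; rewrite mxE divr1.
rewrite (bigD1 ((s^-1)%g j))//= !mxE permKV eqxx normr1 mulr1 big1 ?addr0// => i.
move=> ij; rewrite !mxE; case: eqP => [sij|]; last by rewrite normr0 mulr0.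
by move: ij; rewrite -sij permK eqxx.
Qed.

(* Boxes with sides eps^(h i), h increasing along the triangle, make the
   off-diagonal contribution to the sides of the image of relative size eps. *)
Lemma mstar_mulmx_trig (W : 'M[R]_n.+1) A (h : 'I_n.+1 -> nat) :
  (forall i j, i != j -> (h i <= h j)%N -> W i j = 0) ->
  (forall i, W i i != 0) ->
  (mstar ((mulmx^~ W) @` A) <= (\prod_i `|W i i|)%:E * mstar A)%E.
Proof.
move=> Wh W0.
pose p : {poly R} := \prod_(j < n.+1)
  (\sum_(i < n.+1) `|W i j| *: 'X ^+ (h i - h j)).
have p0 : p.[0] = \prod_i `|W i i|.
  rewrite horner_prod; apply: eq_bigr => j _.
  rewrite horner_sum (bigD1 j)//= hornerZ hornerXn subnn expr0 mulr1.
  rewrite big1 ?addr0// => i ij; rewrite hornerZ hornerXn.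
  case: (leqP (h i) (h j)) => [hij|hji]; first by rewrite Wh ?normr0 ?mul0r.
  by rewrite expr0n subn_eq0 leqNgt hji mulr0.
have H r : 0 < r -> (mstar ((mulmx^~ W) @` A) <= p.[r]%:E * mstar A)%E.
  move=> r0; pose e : V := \row_i r ^+ h i.
  have e0 i : 0 < e 0 i by rewrite mxE exprn_gt0.
  apply: (le_trans (mstar_mulmx_le _ _ e0)).
  rewrite le_eqVlt; apply/orP; left; apply/eqP; congr (_%:E * _)%E.
  rewrite horner_prod; apply: eq_bigr => j _; rewrite horner_sum mulr_suml.
  apply: eq_bigr => i _; rewrite hornerZ hornerXn !mxE.
  have [->|ij] := eqVneq i j; first by rewrite subnn mulrAC divff ?mul1r ?mulr1// expf_neq0 ?gt_eqF.
  case: (leqP (h i) (h j)) => [hij|hji]; first by rewrite Wh// normr0 mulr0 !mul0r.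
  by rewrite mulrAC mulrC expfB.
rewrite -p0.
have [Aoo|Aoo] := eqVneq (mstar A) +oo%E.
  by rewrite Aoo gt0_muley ?leey// lte_fin p0 prodr_gt0// => i _; rewrite normr_gt0.
have Afin : mstar A \is a fin_num by rewrite ge0_fin_numE ?mstar_ge0// ltey.
rewrite -(fineK Afin) -EFinM -[X in (_ * X)%:E](hornerC _ 0) -hornerM.
apply: horner0_ge => r r0; rewrite hornerM hornerC EFinM fineK//.
exact: H.
Qed.

(** By the LUP decomposition: the permutation and the unit lower triangular factor do not increase
    outer measure, and |det W| is the modulus of the product of the diagonal of the upper factor. *)
Lemma mstar_mulmx (W : 'M[R]_n.+1) A : W \in unitmx ->
  (mstar ((mulmx^~ W) @` A) <= `|\det W|%:E * mstar A)%E.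
Proof.
move=> uW.
have := cormen_lup_correct W; have := cormen_lup_perm W.
have := cormen_lup_detL W; have := @cormen_lup_lower _ _ W.
have := @cormen_lup_upper _ _ W.
case: (cormen_lup W) => -[P L] U /= Uup Llow detL permP PWLU.
have uP : P \in unitmx by case/is_perm_mxP: permP => s ->; exact: unitmx_perm.
have WE : W = invmx P *m (L *m U).
  by rewrite -[L *m U]PWLU -[P * W]/(P *m W) mulKmx.
have permP' : is_perm_mx (invmx P).
  by case/is_perm_mxP: permP => s ->; apply/is_perm_mxP; exists (s^-1)%g; rewrite perm_mxV.
have nP : `|\det (invmx P)| = 1.
  case/is_perm_mxP: permP' => s ->; rewrite det_perm normrX normrN1 expr1n//.
have detW : `|\det W| = \prod_i `|U i i|.
  rewrite WE !det_mulmx !normrM nP detL normr1 !mul1r -det_tr det_trig.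
    by rewrite normr_prod; apply: eq_bigr => i _; rewrite mxE.
  by apply/is_trig_mxP => i j ij; rewrite mxE Uup.
have U0 i : U i i != 0.
  have : \prod_i `|U i i| != 0 by rewrite -detW normr_eq0 -unitfE -unitmxE.
  by rewrite prodf_seq_neq0 => /allP/(_ i (mem_index_enum i)) /=; rewrite normr_eq0.
rewrite detW.
have -> : (mulmx^~ W) @` A = (mulmx^~ U) @` ((mulmx^~ L) @` ((mulmx^~ (invmx P)) @` A)).
  by rewrite !image_comp; apply: eq_imagel => x _ /=; rewrite WE !mulmxA.
(* The entries that vanish must be those with [h i <= h j]: decreasing weights for the upper factor,
   increasing ones for the lower factor below. *)
apply: (le_trans (@mstar_mulmx_trig U _ (fun i => (n - i)%N) _ U0)).
  move=> i j ij; rewrite leq_subLR => h; apply: Uup.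
  by rewrite ltn_neqAle eq_sym ij/=; move: h; have := ltn_ord i; have := ltn_ord j; lia.
apply: lee_wpmul2l; first by rewrite lee_fin prodr_ge0.
apply: (@le_trans _ _ (mstar ((mulmx^~ (invmx P)) @` A))); last exact: mstar_mulmx_perm.
apply: (le_trans (@mstar_mulmx_trig L _ (fun i => i) _ _)).
- by move=> i j ij leij; rewrite Llow// (negbTE ij).
- by move=> i; rewrite Llow// eqxx oner_neq0.
- by rewrite big1 ?mul1e// => i _; rewrite Llow// eqxx normr1.
Qed.

End linear_images.

(** * Borel envelopes and the lower integral *)

Section borel_integral.
Variables (R : realType) (n : nat).
Local Notation V := 'rV[R]_n.+1.
Local Notation BV := (g_sigma_algebraType [set U : set V | open U]).
Implicit Types (A B : set V).

Let mu : {outer_measure set V -> \bar R} := @mstar R n.+1.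
Local Notation CV := (caratheodory_type mu).
Let muC : {measure set CV -> \bar R} := (mu : set CV -> \bar R).

Lemma open_borel (A : set V) : open A -> @measurable _ BV A.
Proof. by move=> oA; apply: sub_sigma_algebra. Qed.

Lemma closed_borel (A : set V) : closed A -> @measurable _ BV A.
Proof.
move=> cA; rewrite -[A]setCK; apply: measurableC; apply: open_borel.
exact: closed_openC.
Qed.

Lemma closed_box (a b : V) : closed (box a b).
Proof.
have -> : box a b = \bigcap_(i in [set: 'I_n.+1])
    ((fun x : V => x 0 i) @^-1` [set t | a 0 i <= t] `&`
     (fun x : V => x 0 i) @^-1` [set t | t <= b 0 i]).
  apply/seteqP; split=> [x xab i _|x xab i].
    by have /andP[] := xab i.
  by apply/andP; have [] := xab i I.
apply: closed_bigI => i _; apply: closedI; apply: closed_comp;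
  try by move=> x _; exact: coord_continuous.
  exact: closed_ge.
exact: closed_le.
Qed.

(** The envelope is an intersection of near-optimal covers with excess 1/(m+1), whose boxes are
    closed. *)
Lemma borel_envelope A :
  exists C, [/\ @measurable _ BV C, A `<=` C & (mstar C <= mstar A)%E].
Proof.
have [->|Aoo] := eqVneq (mstar A) +oo%E.
  by exists setT; split=> //; rewrite leey.
have {}Aoo : (mstar A < +oo)%E by rewrite ltey.
have /choice[ab abP] (m : nat) : exists ab : nat -> V * V,
    A `<=` \bigcup_k box (ab k).1 (ab k).2 /\
    (\sum_(k <oo) (box_vol (ab k).1 (ab k).2)%:E <= mstar A + (m.+1%:R^-1)%:E)%E.
  have [|a [b ?]] := @mstar_near_cover _ _ A (m.+1%:R^-1) _ Aoo; first by [].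
  by exists (fun k => (a k, b k)).
exists (\bigcap_m \bigcup_k box (ab m k).1 (ab m k).2); split.
- apply: bigcap_measurable => // m _; apply: bigcup_measurable => k _.
  by apply: closed_borel; exact: closed_box.
- by move=> x Ax m _; apply: (abP m).1.
- apply/lee_addgt0Pr => e e0.
  have [m me] := ltr_add_invr e0; rewrite add0r in me.
  apply: (@le_trans _ _ (mstar (\bigcup_k box (ab m k).1 (ab m k).2))).
    by apply: le_mstar; exact: bigcap_inf.
  apply: (le_trans (mstar_sum_box (fun _ => id))).
  apply: (le_trans (abP m).2); apply: leeD2l; rewrite lee_fin ltW//.
Qed.

Lemma borel_fun_measurable (g : V -> \bar R) :
  borel_fun g <-> measurable_fun [set: BV] g.
Proof.
split=> [bg _ B mB|mg B mB]; first by rewrite setTI; exact: bg.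
by have := mg (@measurableT _ BV) B mB; rewrite setTI.
Qed.

Lemma borel_fun_lmeasurable (g : V -> \bar R) :
  borel_fun g -> measurable_fun [set: CV] g.
Proof. by move=> bg _ B mB; rewrite setTI; apply: borel_lmeasurable; exact: bg. Qed.

(** Together with [integral_le_mint] this identifies [mint setT] on nonnegative measurable functions
    with the integral for the Caratheodory measure, from which additivity and monotone convergence
    are borrowed. *)
Lemma mint_le_integral (h : V -> \bar R) : (forall x, (0 <= h x)%E) ->
  measurable_fun [set: CV] h -> (mint setT h <= \int[muC]_x h x)%E.
Proof.
move=> h0 mh; apply: ge_ereal_sup => _ [k [c [A [c0 [mA [_ [dA [cA ->]]]]]]]].
rewrite (eq_bigr (fun i => \int[muC]_x (c i * \1_(A i : set CV) x)%:E))%E; last first.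
  move=> i _; rewrite (@integralZl_indic _ _ _ muC setT _ (fun=> A i))//.
  - rewrite integral_indic//; last exact: mA.
    by apply: (congr1 (fun B => (c i)%:E * mstar B)%E); exact/esym/setIT.
  - by rewrite ltNge c0.
  - exact: mA.
rewrite -(@ge0_integral_sum _ _ _ muC setT measurableT _ (fun i x => (c i * \1_(A i : set CV) x)%:E))//; last 2 first.
- move=> i; apply/measurable_EFinP; apply: measurable_funM => //.
  by apply: measurable_indic; exact: mA.
- by move=> i x _; rewrite lee_fin mulr_ge0// indicE.
apply: ge0_le_integral => //.
- by move=> x _; apply: sume_ge0 => i _; rewrite lee_fin mulr_ge0// indicE.
- apply: emeasurable_sum => i; apply/measurable_EFinP; apply: measurable_funM => //.
  by apply: measurable_indic; exact: mA.
move=> x _; have [[i Aix]|nA] := pselect (exists i, A i x).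
  rewrite (bigD1 i)//= big1 ?adde0; last first.
    move=> j ji; rewrite indicE memNset ?mulr0// => Ajx.
    by have : (A j `&` A i) x by []; rewrite dA.
  by rewrite indicE mem_set// mulr1; exact: cA.
rewrite big1 => [|i _]; first exact: h0.
by rewrite indicE memNset ?mulr0// => Aix; apply: nA; exists i.
Qed.

(** The fibres of a simple function below g serve as the disjoint pieces of [mint]. *)
Lemma integral_le_mint (g : V -> \bar R) : (forall x, (0 <= g x)%E) ->
  (\int[muC]_x g x <= mint setT g)%E.
Proof.
move=> g0; rewrite ge0_integralTE//; apply: ge_ereal_sup => _ [h hg <-].
rewrite sintegralE fsbig_finite//=.
set s := fset_set _.
apply: ereal_sup_ubound; exists (size s), (fun i : 'I_(size s) => s`_i),
  (fun i : 'I_(size s) => h @^-1` [set s`_i]).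
split; [|split; [|split; [|split; [|split]]]] => //.
- move=> i; have : s`_i \in s by exact: mem_nth.
  by rewrite in_fset_set// => /set_mem[x _ <-].
- by move=> i; exact: (measurable_funPTI h (measurable_set1 _)).
- move=> i j ij; rewrite -subset0 => x [/= ->] /eqP; rewrite nth_uniq//.
    by move=> /eqP/val_inj/eqP; apply/negP.
  exact: fset_uniq.
- by move=> i x /= <-; exact: hg.
- by rewrite (big_nth 0%R) big_mkord.
Qed.

(** The shape of the density built at the end: a given density, a series of indicators, and the
    value +oo on a null set, which contributes nothing. *)
Lemma mint_series_le (g : V -> \bar R) (c : nat -> R) (C : nat -> set V) Z :
  (forall x, (0 <= g x)%E) -> borel_fun g -> (forall i, 0 <= c i) ->
  (forall i, @measurable _ BV (C i)) -> @measurable _ BV Z -> mstar Z = 0%E ->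
  (mint setT (fun x => g x + \sum_(i <oo) (c i * \1_(C i) x)%:E +
      if x \in Z then +oo else 0) <=
   mint setT g + \sum_(i <oo) ((c i)%:E * mstar (C i)))%E.
Proof.
move=> g0 bg c0 mC mZ Z0.
have mCC i : @measurable _ CV (C i) by apply: borel_lmeasurable; exact: mC.
have mZC : @measurable _ CV Z by apply: borel_lmeasurable; exact: mZ.
have t0 i x : (0 <= (c i * \1_(C i : set CV) x)%:E)%E.
  by rewrite lee_fin mulr_ge0// indicE.
have mt i : measurable_fun [set: CV] (fun x => (c i * \1_(C i : set CV) x)%:E).
  by apply/measurable_EFinP; apply: measurable_funM => //; exact: measurable_indic.
have z0 (x : CV) : (0 <= if x \in Z then +oo else 0 :> \bar R)%E by case: ifP.
have mz : measurable_fun [set: CV] (fun x => if x \in Z then +oo%E else 0%E : \bar R).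
  apply: measurable_fun_ifT => //.
  apply: (@measurable_fun_bool _ CV _ _ true); rewrite setTI.
  rewrite (_ : _ @^-1` _ = Z)//; by apply/seteqP; split=> x /=; [exact: set_mem|exact: mem_set].
have mg := borel_fun_lmeasurable bg.
have ms : measurable_fun [set: CV] (fun x => \sum_(i <oo) (c i * \1_(C i : set CV) x)%:E)%E.
  by apply: ge0_emeasurable_sum => // i x _ _; exact: t0.
have s0 x : (0 <= \sum_(i <oo) (c i * \1_(C i : set CV) x)%:E)%E.
  by apply: nneseries_ge0 => i _ _; exact: t0.
apply: (le_trans (mint_le_integral _ _)).
- by move=> x; rewrite !adde_ge0.
- by apply: emeasurable_funD => //; exact: emeasurable_funD.
rewrite ge0_integralD//; last 2 first.
- by move=> x _; rewrite adde_ge0.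
- exact: emeasurable_funD.
have -> : (\int[muC]_x (if x \in Z then +oo else 0) = 0)%E.
  rewrite (ge0_negligible_integral mZC)//.
  by apply: integral0_eq => x [_ nZ]; rewrite memNset.
rewrite adde0 ge0_integralD//; apply: leeD; first exact: integral_le_mint.
rewrite integral_nneseries//.
apply: lee_nneseries => [i _ _|i _]; first by apply: integral_ge0 => x _; exact: t0.
rewrite (@integralZl_indic _ _ _ muC setT _ (fun=> C i))//; last by rewrite ltNge c0.
by rewrite integral_indic//; apply: lee_wpmul2l; rewrite ?lee_fin//; apply: le_mstar; exact: subIsetl.
Qed.

End borel_integral.

(** * Differentiability and volume distortion *)

Section euclidean_norm.
Variables (R : realType) (n : nat).
Local Notation V := 'rV[R]_n.+1.
Implicit Types (u v : V).

Lemma enorm_ge0 v : 0 <= enorm v. Proof. exact: sqrtr_ge0. Qed.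

Lemma enorm_sqr v : enorm v ^+ 2 = \sum_i (v 0 i) ^+ 2.
Proof. by rewrite sqr_sqrtr// sumr_ge0// => i _; exact: sqr_ge0. Qed.

Lemma enormZ (c : R) v : enorm (c *: v) = `|c| * enorm v.
Proof.
rewrite /enorm (eq_bigr (fun i => c ^+ 2 * v 0 i ^+ 2)); last first.
  by move=> i _; rewrite mxE exprMn.
by rewrite -mulr_sumr sqrtrM ?sqr_ge0// sqrtr_sqr.
Qed.

Lemma enormN v : enorm (- v) = enorm v.
Proof. by rewrite -scaleN1r enormZ normrN1 mul1r. Qed.

Lemma norm_le_enorm v : `|v| <= enorm v.
Proof.
apply: norm_le_coord => i; rewrite -(@ler_pXn2r _ 2)// ?nnegrE ?enorm_ge0//.
by rewrite enorm_sqr real_normK ?num_real// (bigD1 i)//= lerDl sumr_ge0// => j _; exact: sqr_ge0.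
Qed.

Lemma enorm0_eq0 v : enorm v = 0 -> v = 0.
Proof. by move=> v0; apply/eqP; rewrite -normr_le0 -v0 norm_le_enorm. Qed.

Lemma enorm0 : enorm (0 : V) = 0.
Proof. by rewrite -(scale0r 0) enormZ normr0 mul0r. Qed.

(** Cauchy-Schwarz, by summing [(b * u 0 i - a * v 0 i) ^+ 2 >= 0] over i, where a and b are the
    norms of u and v. *)
Lemma enorm_dot u v : \sum_i u 0 i * v 0 i <= enorm u * enorm v.
Proof.
have [u0|u0] := eqVneq (enorm u) 0.
  by rewrite u0 mul0r (enorm0_eq0 u0) big1// => i _; rewrite mxE mul0r.
have [v0|v0] := eqVneq (enorm v) 0.
  by rewrite v0 mulr0 (enorm0_eq0 v0) big1// => i _; rewrite mxE mulr0.
have {}u0 : 0 < enorm u by rewrite lt0r u0 enorm_ge0.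
have {}v0 : 0 < enorm v by rewrite lt0r v0 enorm_ge0.
set a := enorm u in u0 *; set b := enorm v in v0 *.
rewrite -(@ler_pM2l _ (2 * (a * b))) ?mulr_gt0//.
have -> : 2 * (a * b) * (a * b) =
    b ^+ 2 * (\sum_i u 0 i ^+ 2) + a ^+ 2 * (\sum_i v 0 i ^+ 2).
  by rewrite -!enorm_sqr -/a -/b; ring.
rewrite !mulr_sumr -big_split/=; apply: ler_sum => i _.
rewrite -subr_ge0 (_ : _ - _ = (b * u 0 i - a * v 0 i) ^+ 2) ?sqr_ge0//; ring.
Qed.

Lemma ler_enormD u v : enorm (u + v) <= enorm u + enorm v.
Proof.
rewrite -(@ler_pXn2r _ 2)// ?nnegrE ?addr_ge0 ?enorm_ge0//.
rewrite sqrrD !enorm_sqr.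
rewrite (eq_bigr (fun i => u 0 i ^+ 2 + (u 0 i * v 0 i) *+ 2 + v 0 i ^+ 2)); last first.
  by move=> i _; rewrite mxE sqrrD.
rewrite big_split/= big_split/= lerD2r lerD2l sumrMnl lerMn2r/=.
exact: enorm_dot.
Qed.

Lemma enormBC u v : enorm (u - v) = enorm (v - u).
Proof. by rewrite -enormN opprB. Qed.

Lemma ler_enorm_triangle u v w : enorm (u - w) <= enorm (u - v) + enorm (v - w).
Proof. by rewrite -[u - w](subrKA v) ler_enormD. Qed.

Lemma enorm_le_norm v : enorm v <= n.+1%:R * `|v|.
Proof.
rewrite -(@ler_pXn2r _ 2)// ?nnegrE ?enorm_ge0 ?mulr_ge0//.
rewrite enorm_sqr exprMn.
apply: (@le_trans _ _ (\sum_(i < n.+1) `|v| ^+ 2)).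
  apply: ler_sum => i _; rewrite -[leLHS]real_normK ?num_real//.
  by rewrite lerXn2r ?nnegrE// le_coord_norm.
rewrite sumr_const card_ord -[leLHS]mulr_natl ler_wpM2r ?sqr_ge0//.
by rewrite expr2 -natrM ler_nat leq_pmulr.
Qed.

Lemma ler_dist_enorm u v : `|enorm u - enorm v| <= n.+1%:R * `|u - v|.
Proof.
apply: le_trans (enorm_le_norm _).
have := ler_enormD (u - v) v; have := ler_enormD (v - u) u.
by rewrite !subrK [enorm (v - u)]enormBC => h1 h2; rewrite ler_norml; apply/andP; split; lra.
Qed.

Definition mx_bound (A : 'M[R]_n.+1) : R := \sum_i \sum_j `|A i j|.

Lemma mx_bound_ge0 A : 0 <= mx_bound A.
Proof. by apply: sumr_ge0 => i _; apply: sumr_ge0. Qed.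

Lemma norm_mulmx_le v A : `|v *m A| <= mx_bound A * `|v|.
Proof.
apply: norm_le_coord => j; rewrite mxE (le_trans (ler_norm_sum _ _ _))//.
rewrite mulr_suml ler_sum// => i _; rewrite normrM mulrC.
apply: ler_pM => //; last exact: le_coord_norm.
by rewrite (bigD1 j)//= lerDl sumr_ge0.
Qed.

(** Testing on the sign vector of a column bounds its absolute sum by c. The Leibniz sum is part of
    the expanded product of the column sums, since permutations are among all maps of the indices.
    There is no factorial loss, which is what lets [up_set_jac] recover |J| < M exactly. *)
Lemma norm_det_le (A : 'M[R]_n.+1) (c : R) :
  (forall v, `|v *m A| <= c * `|v|) -> `|\det A| <= c ^+ n.+1.
Proof.
move=> Ac.
have col j : \sum_i `|A i j| <= c.
  pose v : V := \row_i Num.sg (A i j).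
  have : (v *m A) 0 j = \sum_i `|A i j|.
    by rewrite mxE; apply: eq_bigr => i _; rewrite mxE -normrEsg.
  move=> <-; rewrite (le_trans (ler_norm _))// (le_trans (le_coord_norm _ _))//.
  have c0 : 0 <= c.
    have := le_trans (normr_ge0 _) (Ac (const_mx 1)).
    rewrite pmulr_lge0// normr_gt0; apply/eqP => /matrixP/(_ 0 0).
    by rewrite !mxE => /eqP; rewrite oner_eq0.
  rewrite (le_trans (Ac v))// ler_piMr//.
  by apply: norm_le_coord => i; rewrite mxE normr_sg lern1 leq_b1.
rewrite -det_tr; apply: (le_trans (ler_norm_sum _ _ _)).
apply: (@le_trans _ _ (\sum_(s : {perm 'I_n.+1}) \prod_i `|A (s i) i|)).
  apply: ler_sum => s _; rewrite normrM normrX normrN1 expr1n mul1r normr_prod.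
  by apply: ler_prod => i _; rewrite mxE lexx normr_ge0.
apply: (@le_trans _ _ (\prod_i \sum_k `|A k i|)); last first.
  rewrite -[X in _ <= _ ^+ X]card_ord -prodr_const.
  by apply: ler_prod => i _; rewrite col andbT sumr_ge0.
rewrite bigA_distr_bigA/=.
pose h (s : {perm 'I_n.+1}) := [ffun i => s i].
have hinj : injective h.
  by move=> s s' /ffunP hs; apply/permP => i; have := hs i; rewrite !ffunE.
rewrite [leRHS](bigID (mem (h @: predT))) big_imset/=; last first.
  by move=> s s' _ _ /hinj.
rewrite -[leLHS]addr0 lerD ?sumr_ge0//; last by move=> g _; apply: prodr_ge0.
rewrite le_eqVlt; apply/orP; left; apply/eqP; apply: eq_big => [s|s _].
  by [].
by apply: eq_bigr => i _; rewrite ffunE.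
Qed.

End euclidean_norm.

(** * Two-point conditions and the derivative *)

Section difference_pieces.
Variables (R : realType) (n : nat).
Local Notation V := 'rV[R]_n.+1.
Local Notation BV := (g_sigma_algebraType [set U : set V | open U]).
Implicit Types (f : V -> V) (O D : set V) (x h : V).

Lemma diff_approx f x (e : R) : differentiable f x -> 0 < e ->
  exists2 d : R, 0 < d & forall y, `|y - x| < d ->
    `|f y - f x - 'd f x (y - x)| <= e * `|y - x|.
Proof.
move=> dfx e0.
have /eqaddoP/(_ e e0) := diff_locally dfx.
move=> /nbhs_ballP[d /= d0 H]; exists d => // y yx.
have yb : ball (0 : V) d (y - x) by rewrite mx_norm_ball /ball_/= sub0r normrN.
by have := H _ yb; rewrite /= !fctE /= subrK opprD addrA.
Qed.

(* [Psi] stands for the comparison function of a two-point condition on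
   (f x - f x', x - x'), such as an expansion or a Lipschitz bound. *)
Definition dpiece (Psi : V -> V -> R) f O : set V :=
  [set x | O x /\ forall y, O y -> 0 <= Psi (f x - f y) (x - y)].

(** What is needed to pass between difference quotients and the derivative: homogeneity scales out
    the increment, and the Lipschitz bound absorbs the differentiability error. *)
Definition lip_homogeneous (K : R) (Psi : V -> V -> R) : Prop :=
  (forall u v u' v', `|Psi u v - Psi u' v'| <= K * (`|u - u'| + `|v - v'|)) /\
  (forall t u v, 0 <= t -> Psi (t *: u) (t *: v) = t * Psi u v).

Definition rball (zr : 'rV[rat]_n.+1 * rat) : set V :=
  ball (map_mx ratr zr.1 : V) (ratr zr.2).

Lemma rball_near x (d : R) : 0 < d ->
  exists2 zr, rball zr x & forall y, rball zr y -> `|y - x| < d.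
Proof.
move=> d0; have [|r] := @rat_in_itvoo R (d / 4) (d / 2); first by lra.
rewrite in_itv/= => /andP[r1 r2].
have zP (i : 'I_n.+1) : exists q : rat, x 0 i - d / 4 < ratr q < x 0 i + d / 4.
  have [|q] := @rat_in_itvoo R (x 0 i - d / 4) (x 0 i + d / 4); first by lra.
  by rewrite in_itv; exists q.
have [z {}zP] := choice zP.
have xz : `|x - map_mx ratr (\row_i z i)| <= d / 4.
  apply: norm_le_coord => i; rewrite !mxE.
  by have /andP[h1 h2] := zP i; rewrite ler_norml; apply/andP; split; lra.
exists (\row_i z i, r).
  by rewrite /rball mx_norm_ball /ball_/= distrC (le_lt_trans xz).
move=> y; rewrite /rball mx_norm_ball /ball_/= distrC /= => yz.
rewrite -[y - x](subrKA (map_mx ratr (\row_i z i))).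
rewrite (le_lt_trans (ler_normD _ _))// [X in _ + X]distrC; lra.
Qed.

Lemma open_rball zr : open (rball zr).
Proof. exact: ball_open. Qed.

Variables (K : R) (Psi : V -> V -> R).
Hypothesis PsiK : lip_homogeneous K Psi.

Let K0 : 0 <= K.
Proof.
have := PsiK.1 (const_mx 1) 0 0 0; rewrite !subr0 normr0 addr0.
have c1 : 0 < `|const_mx 1 : V|.
  rewrite normr_gt0; apply/eqP => /matrixP/(_ 0 0).
  by rewrite !mxE => /eqP; rewrite oner_eq0.
by move/(le_trans (normr_ge0 _)); rewrite pmulr_lge0.
Qed.

(** For a fixed y the violation of the condition is open in x, so the complement within O is a union
    of open sets over all y, and no countability in y is involved. *)
Lemma dpiece_borel f O : open O -> {in O, continuous f} ->
  @measurable _ BV (dpiece Psi f O).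
Proof.
move=> oO cf.
have -> : dpiece Psi f O = O `&` ~` (\bigcup_(y in O)
    (O `&` [set x | Psi (f x - f y) (x - y) < 0])).
  apply/seteqP; split=> [x [Ox H]|x [Ox H]]; split=> //.
    by move=> [y Oy [_ /=]]; rewrite ltNge H.
  move=> y Oy; rewrite leNgt; apply/negP => xy; apply: H.
  by exists y => //; split.
apply: measurableI; first exact: open_borel.
apply: measurableC; apply: open_borel; apply: bigcup_open => y Oy.
rewrite openE => x [Ox /= xy].
have K1 : 0 < K + 1 by rewrite ltr_wpDl.
pose e := - Psi (f x - f y) (x - y) / (2 * (K + 1)).
have e0 : 0 < e by rewrite divr_gt0 ?oppr_gt0// mulr_gt0.
have Ke : K * (e + e) < - Psi (f x - f y) (x - y).
  have -> : - Psi (f x - f y) (x - y) = (K + 1) * (e + e).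
    by rewrite /e; field; rewrite gt_eqF.
  by rewrite ltr_pM2r ?addr_gt0// ltrDl.
have /cf/cvgrPdist_lt/(_ e e0) fx : x \in O by exact: mem_set.
have xx : \forall z \near x, `|x - z| < e.
  by apply/nbhs_ballP; exists e => //= z; rewrite mx_norm_ball.
have xO : \forall z \near x, O z by exact: open_nbhs_nbhs.
near=> z; split; first by near: z.
have h1 : `|f x - f z| < e by near: z.
have h2 : `|x - z| < e by near: z.
have /= := PsiK.1 (f z - f y) (z - y) (f x - f y) (x - y).
have -> : f z - f y - (f x - f y) = - (f x - f z) by rewrite !opprB addrA subrK.
have -> : z - y - (x - y) = - (x - z) by rewrite !opprB addrA subrK.
rewrite !normrN => h3.
have : K * (`|f x - f z| + `|x - z|) <= K * (e + e).
  by rewrite ler_wpM2l// lerD// ltW.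
move: h3; rewrite ler_norml => /andP[_]; lra.
Unshelve. all: by end_near. Qed.

(** The condition is tested at y = x - t h and divided by t; the Lipschitz bound leaves an
    arbitrarily small error e. *)
Lemma dpiece_diff_ge0 f O x : open O -> differentiable f x ->
  dpiece Psi f O x -> forall h, 0 <= Psi ('d f x h) h.
Proof.
move=> oO dfx [Ox H] h; have [->|h0] := eqVneq h 0.
  have := PsiK.2 0 0 0 (lexx _); rewrite !scaler0 mul0r linear0 => ->//.
have nh : 0 < `|h| by rewrite normr_gt0.
apply/ler_addgt0Pr => e e0.
have K1 : 0 < K + 1 by rewrite ltr_wpDl.
pose e' := e / (K + 1) / `|h|.
have e'0 : 0 < e' by rewrite !divr_gt0.
have [d d0 dP] := diff_approx dfx e'0.
have [r /= r0 rO] : nbhs_ball x O by rewrite nbhs_ballE; exact: open_nbhs_nbhs.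
(* Makes |t h| half of [min d r], so that y stays in O and in the ball where the differentiability
   estimate holds. *)
pose t := Num.min d r / (2 * `|h|).
have m0 : 0 < Num.min d r by rewrite lt_min d0 r0.
have t0 : 0 < t by rewrite divr_gt0// mulr_gt0.
have th : t * `|h| < Num.min d r.
  have -> : t * `|h| = Num.min d r / 2 by rewrite /t; field; rewrite gt_eqF.
  lra.
have thn : `|t *: h| = t * `|h| by rewrite normrZ gtr0_norm.
move: th; rewrite lt_min => /andP[td tr].
pose y := x - t *: h.
have Oy : O y.
  by apply: rO; rewrite mx_norm_ball /ball_/= /y opprB addrC subrK thn.
have yx : y - x = - (t *: h) by rewrite /y addrAC subrr add0r.
have xy : x - y = t *: h by rewrite -opprB yx opprK.
have := dP y; rewrite yx normrN thn => /(_ td) yd.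
have := H y Oy; rewrite xy => H1.
have := PsiK.1 (f x - f y) (t *: h) ('d f x (t *: h)) (t *: h).
rewrite subrr normr0 addr0 linearN/= in yd *.
rewrite -normrN (_ : - (f x - f y - _) = f y - f x - - 'd f x (t *: h)); last first.
  by rewrite !opprB opprK addrC.
move=> H2; have {H2} H2 := le_trans H2 (ler_wpM2l K0 yd).
move: H2; rewrite linearZ/= (PsiK.2 _ _ _ (ltW t0)) ler_norml => /andP[_ H2].
have : K * (e' * (t * `|h|)) <= t * e.
  have -> : e' * (t * `|h|) = t * e / (K + 1) by rewrite /e'; field; rewrite !gt_eqF.
  by rewrite mulrA ler_pdivrMr// mulrDr mulr1 [K * _]mulrC lerDl mulr_ge0 ?(ltW t0) ?(ltW e0).
move=> H3; rewrite -(@ler_pM2l _ t)// mulr0 mulrDr; lra.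
Qed.

(** The margin eta absorbs the differentiability error on a small ball, and a rational ball around x
    fits inside that one. *)
Lemma dpiece_intro D f x (eta : R) : open D -> D x -> differentiable f x ->
  0 < eta -> (forall h, eta * `|h| <= Psi ('d f x h) h) ->
  exists zr, dpiece Psi f (D `&` rball zr) x.
Proof.
move=> oD Dx dfx eta0 H.
have K1 : 0 < K + 1 by rewrite ltr_wpDl.
have [d d0 dP] := diff_approx dfx (divr_gt0 eta0 K1).
have [zr xzr zrd] := rball_near x d0.
exists zr; split; first by split.
move=> y [Dy /zrd/dP yd].
have := PsiK.1 (f x - f y) (x - y) ('d f x (x - y)) (x - y).
rewrite subrr normr0 addr0.
rewrite -normrN (_ : - (f x - f y - _) = f y - f x - 'd f x (y - x)); last first.
  by rewrite -[x - y]opprB linearN/= opprK opprD opprB.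
move=> /le_trans/(_ (ler_wpM2l K0 yd)); rewrite (distrC y x).
rewrite ler_norml => /andP[H1 _]; have := H (x - y).
have : K * (eta / (K + 1) * `|x - y|) <= eta * `|x - y|.
  by rewrite mulrA ler_wpM2r// mulrA ler_pdivrMr// mulrDr mulr1 [K * _]mulrC lerDl (ltW eta0).
lra.
Qed.

End difference_pieces.

(** * Borel level sets of l(f') and of the Jacobian *)

Section derivative_levels.
Variables (R : realType) (n : nat).
Local Notation V := 'rV[R]_n.+1.
Local Notation BV := (g_sigma_algebraType [set U : set V | open U]).
Implicit Types (f : V -> V) (O D : set V) (x h : V).

Definition Psi_exp (c : R) (u v : V) : R := enorm u - c * enorm v.

Definition Psi_lip (U : 'M[R]_n.+1) (c : R) (u v : V) : R := c * `|v| - `|u *m U|.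

Lemma Psi_exp_lip c : lip_homogeneous ((1 + `|c|) * n.+1%:R) (Psi_exp c).
Proof.
split=> [u v u' v'|t u v t0]; last first.
  by rewrite /Psi_exp !enormZ ger0_norm//; ring.
have -> : Psi_exp c u v - Psi_exp c u' v' =
    (enorm u - enorm u') - c * (enorm v - enorm v') by rewrite /Psi_exp; ring.
apply: (le_trans (ler_normB _ _)); rewrite normrM.
have h1 := ler_dist_enorm u u'; have h2 := ler_dist_enorm v v'.
rewrite mulrDr lerD//.
  by rewrite (le_trans h1)// ler_wpM2r// ler_peMl// lerDl.
apply: (@le_trans _ _ (`|c| * (n.+1%:R * `|v - v'|))); first by rewrite ler_wpM2l.
by rewrite mulrA ler_wpM2r// ler_wpM2r// lerDr.
Qed.

Lemma Psi_lip_lip U c : lip_homogeneous (`|c| + mx_bound U) (Psi_lip U c).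
Proof.
split=> [u v u' v'|t u v t0]; last first.
  by rewrite /Psi_lip -scalemxAl !normrZ ger0_norm//; ring.
have -> : Psi_lip U c u v - Psi_lip U c u' v' =
    c * (`|v| - `|v'|) - (`|u *m U| - `|u' *m U|) by rewrite /Psi_lip; ring.
apply: (le_trans (ler_normB _ _)); rewrite normrM addrC.
rewrite mulrDl !mulrDr.
have h1 : `| `|u *m U| - `|u' *m U| | <= mx_bound U * `|u - u'|.
  by apply: le_trans (norm_mulmx_le _ _); rewrite mulmxBl ler_dist_dist.
have h2 : `|c| * `| `|v| - `|v'| | <= `|c| * `|v - v'|.
  by rewrite ler_wpM2l// ler_dist_dist.
have h3 : 0 <= mx_bound U * `|v - v'| by rewrite mulr_ge0 ?mx_bound_ge0.
have h4 : 0 <= `|c| * `|u - u'| by rewrite mulr_ge0.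
lra.
Qed.

Lemma enorm_delta : enorm (delta_mx 0 0 : V) = 1.
Proof.
rewrite /enorm (bigD1 ord0)//= mxE !eqxx expr1n big1 ?addr0 ?sqrtr1// => i i0.
by rewrite mxE (negbTE i0) andbF expr0n.
Qed.

Lemma lmin_has_inf f x :
  has_inf [set enorm ('d f x h) | h in [set h : V | enorm h = 1]].
Proof.
split; first by exists (enorm ('d f x (delta_mx 0 0))), (delta_mx 0 0) => //=; exact: enorm_delta.
by exists 0 => _ [h _ <-]; exact: enorm_ge0.
Qed.

Lemma lmin_le f x h : lmin f x * enorm h <= enorm ('d f x h).
Proof.
have [h0|h0] := eqVneq (enorm h) 0; first by rewrite h0 mulr0 enorm_ge0.
have h_gt0 : 0 < enorm h by rewrite lt0r h0 enorm_ge0.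
have u1 : enorm ((enorm h)^-1 *: h) = 1.
  by rewrite enormZ ger0_norm ?invr_ge0 ?enorm_ge0// mulVf.
have : lmin f x <= enorm ('d f x ((enorm h)^-1 *: h)).
  by apply: ge_inf; [exact: (lmin_has_inf f x).2|exists ((enorm h)^-1 *: h)].
rewrite linearZ/= enormZ ger0_norm ?invr_ge0 ?enorm_ge0// mulrC.
by rewrite ler_pdivlMr.
Qed.

Definition low_index : Type := (('rV[rat]_n.+1 * rat) * rat)%type.

Definition low_piece f D (i : low_index) : set V :=
  dpiece (Psi_exp (ratr i.2)) f (D `&` rball i.1).

Definition low_set f D (c : R) : set V :=
  \bigcup_(i in [set i : low_index | c < ratr i.2]) low_piece f D i.

Definition up_index : Type := (('rV[rat]_n.+1 * rat) * ('M[rat]_n.+1 * rat))%type.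

Definition up_piece f D (i : up_index) : set V :=
  dpiece (Psi_lip (map_mx ratr i.2.1) (ratr i.2.2)) f (D `&` rball i.1).

(* On the piece of index i = (ball, (U, c)) the map x |-> f x *m U is
   c-Lipschitz for the sup norm, so f multiplies volumes by at most
   c ^ n / |det U|. *)
Definition up_adm (M : R) (i : up_index) : Prop :=
  let U : 'M[R]_n.+1 := map_mx ratr i.2.1 in let c : R := ratr i.2.2 in
  [/\ U \in unitmx, 0 <= c & c ^+ n.+1 < M * `|\det U|].

Definition up_set f D (M : R) : set V :=
  \bigcup_(i in [set i : up_index | up_adm M i]) up_piece f D i.

Lemma countable_bigcup_borel (I : countType) (P : set I) (F : I -> set V) :
  (forall i, @measurable _ BV (F i)) -> @measurable _ BV (\bigcup_(i in P) F i).
Proof.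
move=> mF; rewrite bigcup_mkcond; apply: countable_bigcupT_measurable => [|i].
  exact: countableP.
by case: ifP.
Qed.

Section levels.
Variables (f : V -> V) (D : set V).
Hypothesis oD : open D.
Hypothesis cf : {in D, continuous f}.

Let oball zr : open (D `&` rball zr).
Proof. by apply: openI => //; exact: open_rball. Qed.

Let cball zr : {in D `&` rball zr, continuous f}.
Proof. by move=> x /set_mem[Dx _]; apply: cf; exact: mem_set. Qed.

Lemma low_piece_borel i : @measurable _ BV (low_piece f D i).
Proof. by apply: (dpiece_borel (Psi_exp_lip _)). Qed.

Lemma low_set_borel c : @measurable _ BV (low_set f D c).
Proof. by apply: countable_bigcup_borel => i; exact: low_piece_borel. Qed.

Lemma up_piece_borel i : @measurable _ BV (up_piece f D i).
Proof. by apply: (dpiece_borel (Psi_lip_lip _ _)). Qed.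

Lemma up_set_borel M : @measurable _ BV (up_set f D M).
Proof. by apply: countable_bigcup_borel => i; exact: up_piece_borel. Qed.

(** The derivative inherits the expansion factor of a piece, which is strictly above c. Conversely a
    rational c' strictly between c and l(f') leaves the margin l(f') - c' that [dpiece_intro] asks
    for. *)
Lemma low_setP c x : D x -> differentiable f x ->
  low_set f D c x <-> c < lmin f x.
Proof.
move=> Dx dfx; split=> [[i /= ci xi]|clmin].
  apply: lt_le_trans ci _; apply: lb_le_inf; first exact: (lmin_has_inf f x).1.
  move=> _ [h /= h1 <-].
  have := dpiece_diff_ge0 (Psi_exp_lip _) (@oball _) dfx xi h.
  by rewrite /Psi_exp h1 mulr1 subr_ge0.
have [c'] := rat_in_itvoo clmin; rewrite in_itv/= => /andP[cc' c'l].
have [||zr H] := @dpiece_intro _ _ _ _ (Psi_exp_lip (ratr c')) _ _ _ (lmin f x - ratr c') oD Dx dfx.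
- by rewrite subr_gt0.
- move=> h; have := lmin_le f x h; rewrite /Psi_exp.
  have : (lmin f x - ratr c') * `|h| <= (lmin f x - ratr c') * enorm h.
    by rewrite ler_wpM2l ?norm_le_enorm// subr_ge0 ltW.
  lra.
by exists (zr, c').
Qed.

Lemma diff_jacE x h : 'd f x h = h *m lin1_mx ('d f x).
Proof. by rewrite mul_rV_lin1. Qed.

Lemma lmin_gt0 x : jac f x != 0 -> 0 < lmin f x.
Proof.
rewrite /jac; set A := lin1_mx _ => J0.
have uA : A \in unitmx by rewrite unitmxE unitfE.
have c0 : 0 < n.+1%:R * (mx_bound (invmx A) + 1) :> R.
  by rewrite mulr_gt0// ltr_wpDl// mx_bound_ge0.
(* Write h as (h A) A^-1: the factor [n.+1] compares the Euclidean norm with the sup norm, and the +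
   1 keeps the constant positive. *)
apply: (@lt_le_trans _ _ (n.+1%:R * (mx_bound (invmx A) + 1))^-1).
  by rewrite invr_gt0.
apply: lb_le_inf; first exact: (lmin_has_inf f x).1.
move=> _ [h /= h1 <-]; rewrite diff_jacE -/A.
rewrite invf_ple ?posrE//; last first.
  rewrite lt0r enorm_ge0 andbT; apply/eqP => /enorm0_eq0 hA.
  have := h1; rewrite -(mulmxK uA h) hA mul0mx enorm0 => /eqP.
  by rewrite eq_sym oner_eq0.
have e0 : 0 < enorm (h *m A).
  rewrite lt0r enorm_ge0 andbT; apply/eqP => /enorm0_eq0 hA.
  have := h1; rewrite -(mulmxK uA h) hA mul0mx enorm0 => /eqP.
  by rewrite eq_sym oner_eq0.
rewrite -(@ler_pM2r _ (enorm (h *m A)))// mulVf ?gt_eqF//.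
rewrite -{1}h1 -{1}(mulmxK uA h) (le_trans (enorm_le_norm _))// -mulrA ler_wpM2l//.
rewrite (le_trans (norm_mulmx_le _ _))// ler_pM ?mx_bound_ge0//.
  by rewrite lerDl.
exact: norm_le_enorm.
Qed.

(** The derivative followed by U is again c-Lipschitz, so |J| |det U| <= c^(n+1) < M |det U|. *)
Lemma up_set_jac M x : differentiable f x -> up_set f D M x -> `|jac f x| < M.
Proof.
move=> dfx [i [/=]]; set U := map_mx _ _ => uU c0 cM xi.
have := dpiece_diff_ge0 (Psi_lip_lip _ _) (@oball _) dfx xi.
rewrite /Psi_lip -/U => H.
have dU : 0 < `|\det U| by rewrite normr_gt0 -unitfE -unitmxE.
rewrite -(@ltr_pM2r _ `|\det U|)//; apply: le_lt_trans cM.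
rewrite -normrM -det_mulmx; apply: norm_det_le => v.
by rewrite mulmxA -diff_jacE -subr_ge0.
Qed.

(* U is the identity matrix with one column replaced by a large multiple of a
   kernel vector of A: A U stays bounded while det U is as large as needed. *)
Lemma det_singular_improve (A : 'M[R]_n.+1) (M : R) : 0 < M -> \det A = 0 ->
  exists U : 'M[R]_n.+1, exists c : R, [/\ 0 <= c, c ^+ n.+1 < M * `|\det U| &
    forall v : V, `|v *m A *m U| <= c * `|v|].
Proof.
move=> M0 A0.
have [w w0 Aw] : exists2 w : 'cV[R]_n.+1, w != 0 & A *m w = 0.
  have /eqP := A0; rewrite -det_tr => /det0P[v v0 vA].
  by exists v^T; rewrite ?trmx_eq0// -[A]trmxK -trmx_mul vA trmx0.
have [i wi] : exists i, w i 0 != 0.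
  have /rV0Pn[i] : w^T != 0 by rewrite trmx_eq0.
  by rewrite mxE; exists i.
pose c := mx_bound A; have c0 : 0 <= c by exact: mx_bound_ge0.
pose s := (c ^+ n.+1 + 1) / (M * `|w i 0|).
pose U : 'M[R]_n.+1 := \matrix_(k, j) if j == i then s * w k 0 else (k == j)%:R.
have detU : \det U = s * w i 0.
  rewrite (expand_det_row U i) (bigD1 i)//= big1 ?addr0; last first.
    by move=> j ji; rewrite !mxE (negbTE ji) eq_sym (negbTE ji) mul0r.
  rewrite mxE eqxx /cofactor (_ : row' i (col' i U) = 1%:M) ?det1.
    by rewrite addnn -signr_odd odd_double mulr1 mulr1.
  apply/matrixP => k j; rewrite !mxE eq_sym (negbTE (neq_lift _ _)).
  by rewrite (inj_eq lift_inj).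
exists U, c; split=> //.
  have wn : 0 < `|w i 0| by rewrite normr_gt0.
  rewrite detU normrM ger0_norm; last first.
    by rewrite divr_ge0 ?addr_ge0 ?exprn_ge0// mulr_ge0// ltW.
  rewrite (_ : M * _ = c ^+ n.+1 + 1) ?ltrDl//.
  by rewrite /s; field; rewrite !gt_eqF.
move=> v; apply: le_trans (norm_mulmx_le _ _).
apply: norm_le_coord => j; have [->|ji] := eqVneq j i.
  rewrite mxE (eq_bigr (fun k => s * ((v *m A) 0 k * w k 0))); last first.
    by move=> k _; rewrite !mxE eqxx mulrCA.
  rewrite -mulr_sumr (_ : \sum_k _ = (v *m A *m w) 0 0); last by rewrite [RHS]mxE.
  by rewrite -mulmxA Aw mulmx0 mxE mulr0 normr0.
rewrite mxE (bigD1 j)//= [U j j]mxE (negbTE ji) eqxx mulr1 big1 ?addr0; last first.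
  by move=> k kj; rewrite [U k j]mxE (negbTE ji) (negbTE kj) mulr0.
exact: le_coord_norm.
Qed.

Lemma det_improve (A : 'M[R]_n.+1) (M : R) : `|\det A| < M ->
  exists U : 'M[R]_n.+1, exists c : R, [/\ 0 <= c, c ^+ n.+1 < M * `|\det U| &
    forall v : V, `|v *m A *m U| <= c * `|v|].
Proof.
move=> AM; have [A0|A0] := eqVneq (\det A) 0.
  by apply: det_singular_improve => //; apply: le_lt_trans AM.
have uA : A \in unitmx by rewrite unitmxE unitfE.
exists (invmx A), 1; split=> // [|v]; last by rewrite mulmxK// mul1r.
by rewrite expr1n det_inv normfV ltr_pdivlMr ?normr_gt0// mul1r.
Qed.

Lemma det_continuous : continuous (fun U : 'M[R]_n.+1 => \det U).
Proof.
apply: (@continuous_big R _ +%R 0 xpredT add_continuous) => s _ U.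
rewrite /continuous_at; apply: (@cvgM R _ (nbhs U) _ (fun=> (-1) ^+ s)
  (fun U : 'M[R]_n.+1 => \prod_i U i (s i))); first exact: cvg_cst.
apply: (@continuous_big R _ *%R 1 xpredT mul_continuous) => i _.
exact: coord_continuous.
Qed.

Lemma rat_matrix_near (P : set 'M[R]_n.+1) (U : 'M[R]_n.+1) :
  nbhs U P -> exists U' : 'M[rat]_n.+1, P (map_mx ratr U').
Proof.
move=> /nbhs_ballP[e /= e0 eP].
have UP (ij : 'I_n.+1 * 'I_n.+1) :
    exists q : rat, U ij.1 ij.2 - e < ratr q < U ij.1 ij.2 + e.
  have [|q] := @rat_in_itvoo R (U ij.1 ij.2 - e) (U ij.1 ij.2 + e); first by lra.
  by rewrite in_itv; exists q.
have [g gP] := choice UP; exists (\matrix_(i, j) g (i, j)); apply: eP.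
split=> // i j; rewrite !mxE; have /andP[h1 h2] := gP (i, j).
by rewrite /ball/= ltr_norml; apply/andP; split; rewrite /= in h1 h2; lra.
Qed.

(** The real pair (U, c0) of [det_improve] is perturbed to a rational one. Half of the gap between
    c0 and the rational c pays for replacing U by W, the other half is the margin for
    [dpiece_intro]. *)
Lemma up_set_intro M x : D x -> differentiable f x -> `|jac f x| < M ->
  up_set f D M x.
Proof.
move=> Dx dfx; rewrite /jac; set A := lin1_mx _ => AM.
have [U [c0 [c00 c0M UA]]] := det_improve AM.
have M0 : 0 < M by apply: le_lt_trans AM.
have : \forall c \near c0, c ^+ n.+1 < M * `|\det U|.
  by move: (@exprn_continuous R n.+1 c0) => /cvgr_lt; apply.
move=> /nbhs_ballP[d /= d0 dP].
have [c] := @rat_in_itvoo R c0 (c0 + d) ltac:(lra); rewrite in_itv/= => /andP[c0c cd].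
have cM : ratr c ^+ n.+1 < M * `|\det U|.
  by apply: dP; rewrite /ball/= distrC gtr0_norm; lra.
pose b := mx_bound A + 1; have b0 : 0 < b by rewrite ltr_wpDl// mx_bound_ge0.
(* An entrywise error e gives [mx_bound (W - U)] at most e (n+1)^2, and b bounds A; the product with
   b is exactly half of the gap. *)
pose e := (ratr c - c0) / 2 / b / n.+1%:R / n.+1%:R : R.
have e0 : 0 < e by rewrite !divr_gt0// subr_gt0.
have [U' []] : exists U' : 'M[rat]_n.+1, ratr c ^+ n.+1 < M * `|\det (map_mx ratr U')| /\
    ball U e (map_mx ratr U').
  apply: (@rat_matrix_near (fun U' => ratr c ^+ n.+1 < M * `|\det U'| /\ ball U e U') U).
  apply: filterI; last exact: nbhsx_ballx.
  have : `|\det U'| @[U' --> U] --> `|\det U|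
    by apply: (@cvg_norm _ _ _ (nbhs U)); exact: (@det_continuous U).
  move=> /cvgr_gt H; apply: filterS (H (ratr c ^+ n.+1 / M) _) => [U'|].
    by rewrite ltr_pdivrMr// mulrC.
  by rewrite ltr_pdivrMr// mulrC.
set W := map_mx _ U' => cW UW.
have uW : W \in unitmx.
  rewrite unitmxE unitfE -normr_gt0 -(pmulr_rgt0 _ M0).
  by apply: le_lt_trans cW; rewrite exprn_ge0// ltW// (le_lt_trans c00).
have bUW : mx_bound (W - U) <= e * n.+1%:R * n.+1%:R.
  apply: (@le_trans _ _ (\sum_(i < n.+1) \sum_(j < n.+1) e)).
    apply: ler_sum => i _; apply: ler_sum => j _.
    by have := UW.2 i j; rewrite /ball/= !mxE distrC => /ltW.
  by rewrite !sumr_const card_ord !mulr_natr.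
have [||zr H] := @dpiece_intro _ _ _ _ (Psi_lip_lip W (ratr c)) _ _ _
    ((ratr c - c0) / 2) oD Dx dfx.
- by rewrite divr_gt0// subr_gt0.
- move=> h; rewrite /Psi_lip diff_jacE -/A -{1}[W](subrK U) mulmxDr.
  have h1 := UA h.
  have h2 : `|h *m A *m (W - U)| <= (ratr c - c0) / 2 * `|h|.
    apply: (le_trans (norm_mulmx_le _ _)).
    have h3 : `|h *m A| <= b * `|h|.
      by rewrite (le_trans (norm_mulmx_le _ _))// ler_wpM2r// lerDl.
    apply: (@le_trans _ _ (e * n.+1%:R * n.+1%:R * (b * `|h|))).
      by rewrite ler_pM// mx_bound_ge0.
    rewrite mulrA ler_wpM2r// (_ : e * _ * _ * b = (ratr c - c0) / 2)//.
    rewrite /e; field; apply/andP; split; last by rewrite gt_eqF.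
    by rewrite addrC natr1 pnatr_eq0.
  have := ler_normD (h *m A *m (W - U)) (h *m A *m U).
  lra.
exists (zr, (U', c)) => //; split=> //=.
by rewrite ltW// (le_lt_trans c00).
Qed.

Lemma up_setP M x : D x -> differentiable f x ->
  up_set f D M x <-> `|jac f x| < M.
Proof. by move=> Dx dfx; split=> [|?]; [exact: up_set_jac|exact: up_set_intro]. Qed.

Lemma up_piece_measure M i S : up_adm M i -> S `<=` up_piece f D i ->
  (mstar (f @` S) <= M%:E * mstar S)%E.
Proof.
rewrite /up_adm /up_piece; set U := map_mx _ _; set c := ratr _.
move=> [uU c0 cM] SU.
have dU : 0 < `|\det U| by rewrite normr_gt0 -unitfE -unitmxE.
have -> : f @` S = (mulmx^~ (invmx U)) @` ((fun x => f x *m U) @` S).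
  by rewrite image_comp; apply: eq_imagel => x _ /=; rewrite mulmxK.
apply: (le_trans (mstar_mulmx _ _)); first by rewrite unitmx_inv.
apply: (@le_trans _ _ (`|\det (invmx U)|%:E * ((c ^+ n.+1)%:E * mstar S))%E).
  apply: lee_wpmul2l; first by rewrite lee_fin.
  apply: mstar_image_lipschitz => // x y /SU[Ox xP] /SU[Oy _].
  by have := xP y Oy; rewrite /Psi_lip subr_ge0 mulmxBl.
rewrite muleA -EFinM; apply: lee_wpmul2r; first exact: mstar_ge0.
by rewrite lee_fin det_inv normfV mulrC ler_pdivrMr// ltW.
Qed.

(** S is arbitrary, so the sum over pieces is taken along Borel sets: the pieces are made disjoint
    and only then intersected with S. *)
Lemma up_set_measure M S : S `<=` up_set f D M ->
  (mstar (f @` S) <= M%:E * mstar S)%E.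
Proof.
move=> SM; have [->|/set0P[x0 Sx0]] := eqVneq S set0.
  by rewrite image_set0 mstar0 mule0.
have M0 : 0 <= M.
  have [i [/= uU c0 cM] _] := SM x0 Sx0.
  have dU : 0 < `|\det (map_mx ratr i.2.1 : 'M[R]_n.+1)|.
    by rewrite normr_gt0 -unitfE -unitmxE.
  rewrite -(pmulr_lge0 M dU); apply: le_trans (ltW cM).
  exact: exprn_ge0.
pose F k : set V := if @choice.unpickle up_index k is Some i then
  (if `[< up_adm M i >] then up_piece f D i else set0) else set0.
have mF k : @measurable _ BV (F k).
  rewrite /F; case: (choice.unpickle _) => [i|]; last exact: measurable0.
  by case: ifP => _; [exact: up_piece_borel|exact: measurable0].
have SF : S `<=` \bigcup_k seqDU F k.
  move=> x /SM[i /= Mi xi]; rewrite -seqDU_bigcup_eq; exists (choice.pickle i) => //.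
  by rewrite /F choice.pickleK asboolT.
have FM k : (mstar (f @` (S `&` seqDU F k)) <= M%:E * mstar (S `&` seqDU F k))%E.
  have : S `&` seqDU F k `<=` F k by move=> x [_]; exact: subset_seqDU.
  rewrite {2}/F; case: (choice.unpickle _) => [i|]; last first.
    by rewrite subset0 => ->; rewrite image_set0 mstar0 mule0.
  case: ifPn => [/asboolP Mi|_]; first exact: up_piece_measure.
  by rewrite subset0 => ->; rewrite image_set0 mstar0 mule0.
apply: (@le_trans _ _ (mstar (\bigcup_k f @` (S `&` seqDU F k)))).
  by apply: le_mstar => _ [x Sx <-]; have [k _ xk] := SF x Sx; exists k => //; exists x.
apply: (le_trans (mstar_sigma_subadditive _)).
apply: (@le_trans _ _ (\sum_(k <oo) (M%:E * mstar (S `&` seqDU F k)))%E).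
  by apply: lee_nneseries => [k _ _|k _]; [exact: mstar_ge0|exact: FM].
rewrite nneseriesZl//; last by move=> k _; exact: mstar_ge0.
apply: lee_wpmul2l; first by rewrite lee_fin.
(* Disjoint measurable sets split the outer measure of any test set, here S, countably
   additively. *)
apply: le_trans (@caratheodory_lime_le _ _ (@mstar R n.+1) (seqDU F) _ (trivIset_seqDU F) S).
  by rewrite leeDl// mstar_ge0.
move=> k; apply: borel_lmeasurable.
rewrite /seqDU; apply: (@measurableD _ BV) => //; exact: bigsetU_measurable.
Qed.

End levels.
End derivative_levels.

(** * Arc length *)

Section curve_length.
Variables (R : realType) (n : nat).
Local Notation V := 'rV[R]_n.+1.
Implicit Types (g : R -> V) (a b c : R).

Lemma len_partition g k (t : nat -> R) :
  (forall i, (i < k)%N -> t i <= t i.+1) ->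
  ((\sum_(i < k) enorm (g (t i.+1) - g (t i)))%:E <= len g (t 0%N) (t k))%E.
Proof. by move=> tk; apply: ereal_sup_ubound; exists k, t. Qed.

Lemma partition_le k (t : nat -> R) : (forall i, (i < k)%N -> t i <= t i.+1) ->
  forall i, (i <= k)%N -> t 0%N <= t i <= t k.
Proof.
move=> tk i ik; apply/andP; split.
  elim: i ik => // i IH ik; exact: le_trans (IH (ltnW ik)) (tk _ ik).
elim: k tk ik => [|k IH] tk; first by rewrite leqn0 => /eqP ->.
rewrite leq_eqVlt ltnS => /predU1P[->//|ik].
by apply: le_trans (tk k (leqnn _)); apply: IH => // j jk; exact: tk (ltnW jk).
Qed.

Lemma len_chord g a b : a <= b -> ((enorm (g b - g a))%:E <= len g a b)%E.
Proof.
move=> ab; have := @len_partition g 1 (fun i => if i is 0%N then a else b).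
by rewrite big_ord1; apply => -[].
Qed.

Lemma len_ge0 g a b : a <= b -> (0 <= len g a b)%E.
Proof. by move=> /(len_chord g); apply: le_trans; rewrite lee_fin enorm_ge0. Qed.

Lemma len_append g a b c : b <= c ->
  (len g a b + (enorm (g c - g b))%:E <= len g a c)%E.
Proof.
move=> bc; rewrite -leeBrDr//; apply: ge_ereal_sup => _ [k [t [ta [tb [tk ->]]]]].
rewrite leeBrDr// -EFinD.
pose t' i := if (i <= k)%N then t i else c.
have tE i : (i <= k)%N -> t' i = t i by rewrite /t' => ->.
have t'k : t' k.+1 = c by rewrite /t' ltnn.
apply: ereal_sup_ubound; exists k.+1, t'; split; first by rewrite tE.
split=> //; split.
  move=> i; rewrite ltnS leq_eqVlt => /predU1P[->|ik].
    by rewrite t'k tE// tb.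
  by rewrite !tE// ?tk// ltnW.
rewrite big_ord_recr/= t'k tE// tb; congr (_ + _)%:E.
by apply: eq_bigr => i _; rewrite !tE// ltnW.
Qed.

Lemma len_superadd g a b c : a <= b ->
  (len g a b + len g b c <= len g a c)%E.
Proof.
move=> ab; have part k t : t 0%N = b -> (forall i, (i < k)%N -> t i <= t i.+1) ->
    (len g a b + (\sum_(i < k) enorm (g (t i.+1) - g (t i)))%:E <= len g a (t k))%E.
  move=> t0; elim: k => [_|k IH tk]; first by rewrite big_ord0 adde0 t0.
  rewrite big_ord_recr/= EFinD addeA.
  apply: le_trans (len_append g a (tk k (leqnn _))).
  by apply: leeD2r; apply: IH => i ik; apply: tk; exact: ltnW.
have := len_ge0 g ab; case E : (len g a b) => [x||]//= x0.
  rewrite -leeBrDl//; apply: ge_ereal_sup => _ [k [t [tb [tc [tk ->]]]]].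
  by rewrite leeBrDl// -E -tc; exact: part.
(* If no partition leads from b to c, then [len g b c] is the supremum of the empty set, that is
   -oo. *)
have [bc|] := pselect (exists k, exists t : nat -> R, t 0%N = b /\ t k = c /\
    forall i, (i < k)%N -> t i <= t i.+1).
  case: bc => k [t [tb [tc tk]]].
  by have := part k t tb tk; rewrite E tc addye// leye_eq => /eqP ->; exact: leey.
move=> nbc; rewrite [X in (_ + X <= _)%E](_ : _ = -oo%E) ?addeNy ?leNye//.
rewrite /len [X in ereal_sup X](_ : _ = set0) ?ereal_sup0//.
by rewrite -subset0 => y /= [k [t [h0 [h1 [h2 _]]]]]; apply: nbc; exists k, t.
Qed.

Lemma len_subadd g a b c : a <= b -> b <= c ->
  (len g a c <= len g a b + len g b c)%E.
Proof.
move=> ab bc; apply: ge_ereal_sup => _ [k [t [ta [tc [tk ->]]]]].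
move: bc; rewrite -tc {c tc}.
elim: k tk => [|k IH] tk bc.
  by rewrite big_ord0 adde_ge0// len_ge0.
have tk' i : (i < k)%N -> t i <= t i.+1 by move=> ik; apply: tk; exact: ltnW.
have tkS := tk k (leqnn _).
rewrite big_ord_recr/= EFinD; have [btk|tkb] := leP b (t k).
  apply: (@le_trans _ _ (len g a b + len g b (t k) + (enorm (g (t k.+1) - g (t k)))%:E)%E).
    by apply: leeD2r; exact: IH.
  by rewrite -addeA; apply: leeD2l; exact: len_append.
apply: (@le_trans _ _ (len g a (t k) +
    ((enorm (g b - g (t k)))%:E + (enorm (g (t k.+1) - g b))%:E))%E).
  apply: leeD; first by rewrite -ta; exact: len_partition.
  by rewrite -EFinD lee_fin [leRHS]addrC ler_enorm_triangle.
rewrite addeA; apply: leeD; last exact: len_chord.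
by apply: len_append; exact: ltW.
Qed.

Definition cont_on g a b : Prop := forall s, a <= s <= b -> forall e, 0 < e ->
  exists2 d, 0 < d & forall t, a <= t <= b -> `|t - s| < d -> enorm (g t - g s) < e.

Section arclength.
Variables (g : R -> V) (a b : R).
Hypotheses (ab : a <= b) (glen : (len g a b < +oo)%E) (gcont : cont_on g a b).

Let u t := fine (len g a t).

Lemma len_fin s t : a <= s -> s <= t -> t <= b -> len g s t \is a fin_num.
Proof.
move=> as_ st tb; rewrite ge0_fin_numE ?len_ge0//; apply: le_lt_trans glen.
apply: (@le_trans _ _ (len g a t)).
  apply: le_trans (len_superadd g t as_); rewrite leeDr// len_ge0//.
apply: le_trans (len_superadd g b (le_trans as_ st)); rewrite leeDl// len_ge0//.
Qed.

Lemma arclengthB s t : a <= s -> s <= t -> t <= b -> fine (len g s t) = u t - u s.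
Proof.
move=> as_ st tb; apply/eqP; rewrite eq_sym subr_eq addrC; apply/eqP.
rewrite /u -fineD; [|by apply: len_fin => //; exact: le_trans tb|exact: len_fin].
congr fine; apply/eqP; rewrite eq_le; apply/andP; split.
  exact: len_subadd.
exact: len_superadd.
Qed.

Lemma arclength_chord s t : a <= s -> s <= t -> t <= b ->
  enorm (g t - g s) <= u t - u s.
Proof.
move=> as_ st tb; rewrite -arclengthB// -lee_fin fineK ?len_fin//.
exact: len_chord.
Qed.

Lemma arclength_le s t : a <= s -> s <= t -> t <= b -> u s <= u t.
Proof.
move=> as_ st tb; rewrite -subr_ge0.
exact: le_trans (enorm_ge0 _) (arclength_chord as_ st tb).
Qed.

Lemma arclength0 : u a = 0.
Proof. by have := arclengthB (lexx a) (lexx a) ab; rewrite subrr. Qed.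

Lemma arclength_partition s t (d : R) : a <= s -> s <= t -> t <= b -> 0 < d ->
  exists k, exists p : nat -> R, [/\ p 0%N = s, p k = t,
    (forall i, (i < k)%N -> p i <= p i.+1) &
    u t - u s - d <= \sum_(i < k) enorm (g (p i.+1) - g (p i))].
Proof.
move=> as_ st tb d0.
have [_ [k [p [ps [pt [pk ->]]]]] H] := ub_ereal_sup_adherent d0 (len_fin as_ st tb).
exists k, p; split=> //; rewrite -arclengthB//.
by rewrite -lee_fin EFinB fineK ?len_fin//; exact: ltW.
Qed.

Lemma arclength_partition_le k (p : nat -> R) : a <= p 0%N -> p k <= b ->
  (forall i, (i < k)%N -> p i <= p i.+1) ->
  \sum_(i < k) enorm (g (p i.+1) - g (p i)) <= u (p k) - u (p 0%N).
Proof.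
move=> ap pb pk.
have p0k : p 0%N <= p k by have /andP[] := partition_le pk (leqnn k).
by rewrite -arclengthB// -lee_fin fineK ?len_fin// len_partition.
Qed.

Let near_chord (p s e : R) : a <= p <= b -> a <= s <= b -> p != s -> 0 < e ->
  exists t, [/\ Num.min p s < t, t < Num.max p s & enorm (g t - g s) < e].
Proof.
move=> /andP[ap pb] /andP[as_ sb] ps e0.
have [d d0 dP] := gcont (introT andP (conj as_ sb)) e0.
have [ps'|sp|] := ltgtP p s; last by move=> /eqP; rewrite (negbTE ps).
- pose t := Num.max ((p + s) / 2) (s - d / 2).
  have h1 : (p + s) / 2 <= t by rewrite le_max lexx.
  have h2 : s - d / 2 <= t by rewrite le_max lexx orbT.
  have h3 : t < s by rewrite gt_max; apply/andP; split; lra.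
  exists t; split=> //; first by lra.
  by apply: dP; [apply/andP; split; lra|rewrite ltr_norml; apply/andP; split; lra].
- pose t := Num.min ((p + s) / 2) (s + d / 2).
  have h1 : t <= (p + s) / 2 by rewrite ge_min lexx.
  have h2 : t <= s + d / 2 by rewrite ge_min lexx orbT.
  have h3 : s < t by rewrite lt_min; apply/andP; split; lra.
  exists t; split=> //; first by lra.
  by apply: dP; [apply/andP; split; lra|rewrite ltr_norml; apply/andP; split; lra].
Qed.

(* A jump J of the length at s would be missed by every partition. *)
Lemma arclength_nojump_left s J : a < s -> s <= b ->
  (forall t, a <= t -> t < s -> u t <= u s - J) -> J <= 0.
Proof.
move=> as_ sb HJ.
have chord p : a <= p -> p < s -> enorm (g s - g p) <= u s - J - u p.
  move=> ap ps; apply/ler_addgt0Pr => e e0.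
  have pab : a <= p <= b by rewrite ap (ltW (lt_le_trans ps sb)).
  have sab : a <= s <= b by rewrite sb ltW.
  have [t []] := near_chord pab sab (negbT (lt_eqF ps)) e0.
  rewrite (min_l (ltW ps)) (max_r (ltW ps)) => pt ts gts.
  have h1 := HJ t (le_trans ap (ltW pt)) ts.
  have h2 := arclength_chord ap (ltW pt) (ltW (lt_le_trans ts sb)).
  have := ler_enorm_triangle (g s) (g t) (g p); rewrite [enorm (g s - g t)]enormBC; lra.
(* Induction drops degenerate final cells; the last proper cell then loses J by [chord]. *)
have part k p : p 0%N = a -> p k = s -> (forall i, (i < k)%N -> p i <= p i.+1) ->
    \sum_(i < k) enorm (g (p i.+1) - g (p i)) <= u s - J.
  move=> pa; elim: k => [|k IH] ps pk; first by move: as_; rewrite -pa ps ltxx.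
  have pk' i : (i < k)%N -> p i <= p i.+1 by move=> ik; apply: pk; exact: ltnW.
  rewrite big_ord_recr/=; have := pk k (leqnn _); rewrite ps le_eqVlt => /predU1P[pks|pks].
    by rewrite pks subrr enorm0 addr0; exact: IH.
  have apk : a <= p k by rewrite -pa; have /andP[] := partition_le pk' (leqnn k).
  have h1 := chord _ apk pks.
  have : \sum_(i < k) enorm (g (p i.+1) - g (p i)) <= u (p k) - u (p 0%N).
    by apply: arclength_partition_le => //; rewrite ?pa// (le_trans (ltW pks)).
  rewrite pa arclength0; lra.
apply/ler_addgt0Pr => e e0; rewrite add0r.
have [k [p [pa ps pk]]] := arclength_partition (lexx a) (ltW as_) sb e0.
have := part k p pa ps pk; rewrite arclength0; lra.
Qed.

Lemma arclength_nojump_right s J : a <= s -> s < b ->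
  (forall t, s < t -> t <= b -> u s + J <= u t) -> J <= 0.
Proof.
move=> as_ sb HJ.
have chord p : p <= b -> s < p -> enorm (g p - g s) <= u p - J - u s.
  move=> pb sp; apply/ler_addgt0Pr => e e0.
  have pab : a <= p <= b by rewrite pb (ltW (le_lt_trans as_ sp)).
  have sab : a <= s <= b by rewrite as_ ltW.
  have [t []] := near_chord pab sab (negbT (gt_eqF sp)) e0.
  rewrite (min_r (ltW sp)) (max_l (ltW sp)) => st tp gts.
  have h1 := HJ t st (le_trans (ltW tp) pb).
  have h2 := arclength_chord (le_trans as_ (ltW st)) (ltW tp) pb.
  have := ler_enorm_triangle (g p) (g t) (g s); lra.
have part k p : p 0%N = s -> p k = b -> (forall i, (i < k)%N -> p i <= p i.+1) ->
    \sum_(i < k) enorm (g (p i.+1) - g (p i)) <= u b - u s - J.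
  elim: k p => [|k IH] p ps pb pk; first by move: sb; rewrite -ps pb ltxx.
  have pk' i : (i < k)%N -> p i.+1 <= p i.+2 by move=> ik; exact: pk.
  rewrite big_ord_recl/=; have := pk 0%N isT; rewrite ps le_eqVlt => /predU1P[sp|sp].
    by rewrite -sp subrr enorm0 add0r; exact: (IH (fun i => p i.+1)).
  have /andP[_] := partition_le pk' (leq0n k); rewrite pb => p1b.
  have h1 := chord _ p1b sp.
  have := @arclength_partition_le k (fun i => p i.+1); rewrite pb => /(_ _ (lexx _) pk').
  move=> /(_ (ltW (le_lt_trans as_ sp))); rewrite /bump/=; lra.
apply/ler_addgt0Pr => e e0; rewrite add0r.
have [k [p [pa ps pk]]] := arclength_partition as_ (ltW sb) (lexx b) e0.
have := part k p pa ps pk; lra.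
Qed.

(** Intermediate values of u from the absence of jumps: at s = sup {u <= y}, a gap between u s and y
    on either side would be a jump. *)
Lemma arclength_surj y : 0 <= y <= u b -> exists2 t, a <= t <= b & u t = y.
Proof.
move=> /andP[y0 yb]; pose S := [set t | a <= t <= b /\ u t <= y].
have Sa : S a by split; rewrite ?lexx// arclength0.
have hS : has_sup S by split; [exists a|exists b => t [/andP[_]]].
pose s := sup S.
have as_ : a <= s by apply: sup_upper_bound.
have sb : s <= b by apply: ge_sup; [exists a|move=> t [/andP[_]]].
exists s; first by rewrite as_.
apply/eqP; rewrite eq_le; apply/andP; split; rewrite leNgt; apply/negP => H.
- have as' : a < s.
    rewrite lt_neqAle as_ andbT; apply/eqP => sa.
    by move: H; rewrite -sa arclength0 ltNge y0.
  suff : u s - y <= 0 by lra.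
  apply: (@arclength_nojump_left s) => // t at_ ts; rewrite subKr.
  have st0 : 0 < s - t by rewrite subr_gt0.
  have [t' [/andP[_ t'b] t'y] tt'] := sup_adherent st0 hS.
  by apply: le_trans t'y; apply: arclength_le => //; move: tt'; rewrite subKr => /ltW.
- have sb' : s < b.
    rewrite lt_neqAle sb andbT; apply/eqP => sb'.
    by move: H; rewrite sb' ltNge yb.
  suff : y - u s <= 0 by lra.
  apply: (@arclength_nojump_right s) => // t st tb.
  rewrite addrC subrK leNgt; apply/negP => ty.
  have : t <= s by apply: sup_upper_bound => //; split; [apply/andP; split; lra|exact: ltW].
  by rewrite leNgt st.
Qed.

End arclength.
End curve_length.

Lemma lebesgue_itv_cover (R : realType) (N : set R) (e : R) :
  (lebesgue_measure N < +oo)%E -> 0 < e ->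
  exists F : nat -> R * R, N `<=` \bigcup_i [set t | (F i).1 < t < (F i).2] /\
    (\sum_(i <oo) (Num.max 0 ((F i).2 - (F i).1))%:E <= lebesgue_measure N + e%:E)%E.
Proof.
move=> Noo e0.
have : lebesgue_measure N \is a fin_num by rewrite ge0_fin_numE ?measure_ge0.
rewrite [lebesgue_measure N](_ : _ = ((wlength idfun)^* N)%mu)//.
rewrite outer_measure_open_itv_cover => /lb_ereal_inf_adherent-/(_ _ e0)[_/= [F [Fi NF] <-] Fe].
have /choice[G GF] i : exists ab : R * R, F i = [set` `]ab.1, ab.2[ ].
  by have [ab ->] := Fi i; exists (ab.1, ab.2).
exists G; split.
  by move=> x /NF[i _]; rewrite GF /= in_itv; exists i.
apply: le_trans (ltW Fe); apply: lee_nneseries => [i _ _|i _].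
  by rewrite lee_fin le_max lexx.
rewrite GF wlength_itv/= lte_fin; case: ltP => [ab|ba].
  by rewrite max_r ?subr_ge0// ltW.
by rewrite max_l// subr_le0.
Qed.

(** * Arc-length parametrization *)

Section arclength_param.
Variables (R : realType) (n : nat).
Local Notation V := 'rV[R]_n.+1.
Local Notation BV := (g_sigma_algebraType [set U : set V | open U]).
Variables (g : R -> V) (a b : R).
Hypotheses (ab : a <= b) (glen : (len g a b < +oo)%E) (gcont : cont_on g a b).

Let u t := fine (len g a t).

(** A choice of inverse of the length function, such that [arclen_param g a b s] unfolds to
    [g (arctime s)]. By [arclength_inj] the choice does not affect the point of the curve; outside
    the range the value is a. *)
Definition arctime (s : R) : R :=
  xget a [set t | a <= t <= b /\ fine (len g a t) = s].

Lemma arctimeP s : 0 <= s <= u b -> a <= arctime s <= b /\ u (arctime s) = s.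
Proof.
move=> /(arclength_surj ab glen gcont)[t tab uts]; rewrite /arctime.
by case: xgetP => [y _ []//|/(_ t)]; case.
Qed.

Lemma arclength_range t : a <= t <= b -> 0 <= u t <= u b.
Proof.
move=> /andP[at_ tb]; rewrite -{1}(arclength0 ab glen); apply/andP; split.
  exact: (arclength_le glen).
by apply: (arclength_le glen).
Qed.

Lemma arclength_dist s t : a <= s <= b -> a <= t <= b ->
  enorm (g t - g s) <= `|u t - u s|.
Proof.
wlog st : s t / s <= t.
  move=> H hs ht; have [st|/ltW ts] := leP s t; first exact: H.
  by rewrite enormBC distrC; exact: H.
move=> /andP[as_ sb] /andP[at_ tb].
rewrite ger0_norm; first exact: (arclength_chord glen).
by rewrite subr_ge0; exact: (arclength_le glen).
Qed.

Lemma arclength_inj s t : a <= s <= b -> a <= t <= b -> u s = u t -> g s = g t.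
Proof.
move=> hs ht st; have := arclength_dist hs ht; rewrite st subrr normr0 => h.
by apply/esym/eqP; rewrite -subr_eq0; apply/eqP/enorm0_eq0/eqP; rewrite eq_le h enorm_ge0.
Qed.

Lemma arclen_param_arclength t : a <= t <= b -> arclen_param g a b (u t) = g t.
Proof.
move=> tab; have [h1 h2] := arctimeP (arclength_range tab).
exact: arclength_inj.
Qed.

Lemma arclen_param_dist s t : 0 <= s <= u b -> 0 <= t <= u b ->
  enorm (arclen_param g a b t - arclen_param g a b s) <= `|t - s|.
Proof.
move=> /arctimeP[h1 h2] /arctimeP[h3 h4].
by have := arclength_dist h1 h3; rewrite h2 h4.
Qed.

Lemma arclen_param_borel (A : set V) : @measurable _ BV A ->
  measurable ([set` `[0, u b]] `&` arclen_param g a b @^-1` A).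
Proof.
set I : set R := [set` `[0, u b]]; set y := arclen_param g a b.
have mI : measurable I by exact: measurable_itv.
move=> mA.
suff : <<s [set U : set V | open U] >> `<=` [set A | measurable (I `&` y @^-1` A)] by apply.
apply: smallest_sub; first split => /=.
- by rewrite preimage_set0 setI0.
- move=> B mB; rewrite setTD preimage_setC -setDE.
  rewrite (_ : I `\` _ = I `\` (I `&` y @^-1` B)); last by rewrite setDIr setDv set0U.
  exact: measurableD.
- move=> F mF; rewrite preimage_bigcup setI_bigcupr.
  exact: bigcup_measurable.
move=> U /= oU.
(* W is open in the line and has the same trace on I as the preimage of U, because the
   parametrization is 1-Lipschitz on I. *)
pose W := [set s : R | exists2 d : R, 0 < d & forall t, `|t - s| < d -> I t -> U (y t)].
have -> : I `&` y @^-1` U = I `&` W.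
  apply/seteqP; split=> [s [Is Us]|s [Is [d d0 sd]]]; split=> //; last first.
    by apply: sd => //; rewrite subrr normr0.
  have /nbhs_ballP[d /= d0 dU] : nbhs (y s) U by exact: open_nbhs_nbhs.
  exists d => // t ts It; apply: dU.
  rewrite mx_norm_ball /ball_/= distrC (le_lt_trans (norm_le_enorm _))//.
  apply: le_lt_trans ts; apply: arclen_param_dist.
    by move: Is; rewrite /I/= in_itv.
  by move: It; rewrite /I/= in_itv.
apply: measurableI => //; apply: open_measurable.
rewrite openE => s [d d0 sd]; apply/nbhs_ballP; exists (d / 2) => /=; first by rewrite divr_gt0.
move=> t; rewrite /ball/= => st; exists (d / 2); first by rewrite divr_gt0.
move=> r rt; apply: sd; rewrite -[r - s](subrKA t) (le_lt_trans (ler_normD _ _))//.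
by rewrite [ltRHS](splitr d) ltrD// distrC.
Qed.

Lemma arclen_param_measurable_fun (rho : V -> \bar R) : borel_fun rho ->
  measurable_fun [set` `[0, u b]] (fun s => rho (arclen_param g a b s)).
Proof. by move=> brho _ B mB; apply: (@arclen_param_borel (rho @^-1` B)); exact: brho. Qed.

End arclength_param.

(** * Lengths under a two-point expansion *)

Section arclength_expansion.
Variables (R : realType) (n : nat).
Local Notation V := 'rV[R]_n.+1.
Variables (g h : R -> V) (a b : R).
Hypotheses (ab : a <= b).
Hypotheses (glen : (len g a b < +oo)%E) (hlen : (len h a b < +oo)%E).

Let u t := fine (len g a t).
Let w t := fine (len h a t).

(* In each interval of a near-optimal partition for g, the part of T has
   u-diameter at most (arc - chord) + (h-arc)/c; the first terms sum to d. *)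
Lemma expansion_cover (T : set R) (c d t1 t2 : R) : 0 < c -> 0 < d ->
  a <= t1 -> t1 <= t2 -> t2 <= b ->
  (forall x y, T x -> T y -> c * enorm (g x - g y) <= enorm (h x - h y)) ->
  exists B : set R, [/\ measurable B,
    (forall t, T t -> t1 <= t <= t2 -> B (u t)) &
    (lebesgue_measure B <= (d + (w t2 - w t1) / c)%:E)%E].
Proof.
move=> c0 d0 at1 t12 t2b Tc.
have [k [p [p0 pk kp Hp]]] := arclength_partition glen at1 t12 t2b d0.
pose D i := (u (p i.+1) - u (p i)) - enorm (g (p i.+1) - g (p i)) +
            (w (p i.+1) - w (p i)) / c.
have pab i : (i <= k)%N -> t1 <= p i <= t2.
  by move=> ik; rewrite -p0 -pk; exact: partition_le.
have D0 i : (i < k)%N -> 0 <= D i.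
  move=> ik; have /andP[h1 h2] := pab i (ltnW ik); have /andP[h3 h4] := pab i.+1 ik.
  have := arclength_chord glen (le_trans at1 h1) (kp i ik) (le_trans h4 t2b).
  have := arclength_le hlen (le_trans at1 h1) (kp i ik) (le_trans h4 t2b).
  rewrite -subr_ge0 => h5 h6; rewrite addr_ge0 ?subr_ge0// divr_ge0// ltW//.
have step i : (i < k)%N -> exists B : set R, [/\ measurable B,
    (forall t, T t -> p i <= t <= p i.+1 -> B (u t)) & (lebesgue_measure B <= (D i)%:E)%E].
  move=> ik; have /andP[h1 h2] := pab i (ltnW ik); have /andP[h3 h4] := pab i.+1 ik.
  have api : a <= p i by exact: le_trans h1.
  have pib : p i.+1 <= b by exact: le_trans t2b.
  pose E := [set u t | t in T `&` [set t | p i <= t <= p i.+1]].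
  have ED s s' : E s -> E s' -> s' - s <= D i.
    (* The chord of the cell is at most the g-arcs outside [x, y] plus |g y - g x|. Hence the arc
       from x to y exceeds its chord by no more than the whole cell does, and this chord is bounded
       by the h-arc divided by c. *)
    have key x y : T x -> T y -> p i <= x -> x <= y -> y <= p i.+1 -> u y - u x <= D i.
      move=> Tx Ty px xy yp.
      have ax := le_trans api px; have yb := le_trans yp pib.
      have k1 := arclength_chord glen api px (le_trans xy yb).
      have k2 := arclength_chord glen (le_trans ax xy) yp pib.
      have k3 := Tc y x Ty Tx.
      have k4 := arclength_chord hlen ax xy yb.
      have k5 := arclength_le hlen api px (le_trans xy yb).
      have k6 := arclength_le hlen (le_trans ax xy) yp pib.
      have k7 := ler_enorm_triangle (g (p i.+1)) (g y) (g (p i)).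
      have k8 := ler_enorm_triangle (g y) (g x) (g (p i)).
      have : enorm (g y - g x) <= (w (p i.+1) - w (p i)) / c.
        rewrite ler_pdivlMr// mulrC (le_trans k3)//.
        by apply: (le_trans k4); apply: lerB.
      by rewrite /D /u in k1 k2 *; lra.
    move=> [x [Tx /andP[px xp]] <-] [y [Ty /andP[py yp]] <-].
    have [xy|/ltW yx] := leP x y; first exact: key.
    apply: le_trans (D0 i ik); rewrite subr_le0.
    by apply: (arclength_le glen) => //; [exact: le_trans py|exact: le_trans pib].
  have [E0|/set0P[s0 Es0]] := eqVneq E set0.
    exists set0; split=> //; last by rewrite measure0 lee_fin D0.
    by move=> t Tt pt; have : E (u t) by [exists t]; rewrite E0.
  have hE : has_inf E.
    by split; [exists s0|exists (s0 - D i) => s Es; have := ED _ _ Es Es0; lra].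
  exists [set` `[inf E, inf E + D i]]; split.
  - exact: measurable_itv.
  - move=> t Tt pt /=; have Et : E (u t) by exists t.
    rewrite in_itv/=; apply/andP; split; first by apply: ge_inf => //; exact: hE.2.
    rewrite -lerBlDr; apply: lb_le_inf; first by exists s0.
    by move=> s Es; have := ED _ _ Es Et; lra.
  - rewrite lebesgue_measure_itv/= lte_fin; case: ifP => _; last by rewrite lee_fin D0.
    by rewrite -EFinB lee_fin addrAC subrr add0r.
have glue j : (j <= k)%N -> exists B : set R, [/\ measurable B,
    (forall t, T t -> t1 <= t <= p j -> B (u t)) &
    (lebesgue_measure B <= (\sum_(i < j) D i)%:E)%E].
  elim: j => [_|j IH jk].
    exists [set u t1]; split => //; last by rewrite lebesgue_measure_set1 big_ord0.
    by move=> t Tt; rewrite p0 => /le_anti ->.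
  have [B1 [mB1 B1P lB1]] := IH (ltnW jk); have [B2 [mB2 B2P lB2]] := step j jk.
  exists (B1 `|` B2); split; first exact: measurableU.
    move=> t Tt /andP[t1t tp]; have [tpj|/ltW pjt] := leP t (p j).
      by left; apply: B1P; rewrite ?t1t.
    by right; apply: B2P; rewrite ?pjt.
  rewrite big_ord_recr/= EFinD; apply: le_trans (leeD lB1 lB2).
  exact: measureU2.
have [B [mB BP lB]] := glue k (leqnn _); rewrite pk in BP.
exists B; split=> //; apply: (le_trans lB); rewrite lee_fin.
have tel (v : R -> R) : \sum_(i < k) (v (p i.+1) - v (p i)) = v t2 - v t1.
  rewrite -(big_mkord xpredT (fun i => v (p i.+1) - v (p i))).
  by rewrite (telescope_sumr (fun i => v (p i)))// p0 pk.
rewrite big_split/= sumrB -mulr_suml !tel.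
rewrite lerD2r; move: Hp; rewrite -/(u t2) -/(u t1); lra.
Qed.

End arclength_expansion.

(** * The inverse of L and the measure of its pullbacks *)

Section curve_comparison.
Variables (R : realType) (n : nat).
Local Notation V := 'rV[R]_n.+1.
Local Notation BV := (g_sigma_algebraType [set U : set V | open U]).
Variables (f : V -> V) (g : R -> V) (a b : R).
Let h : R -> V := f \o g.
Hypotheses (ab : a <= b).
Hypotheses (glen : (len g a b < +oo)%E) (gcont : cont_on g a b).
Hypotheses (hlen : (len h a b < +oo)%E) (hcont : cont_on h a b).

Let u t := fine (len g a t).
Let w t := fine (len h a t).
Let leb : {measure set (measurableTypeR R) -> \bar R} := @lebesgue_measure R.

Let leb_itv x y : leb [set` `[x, y]] = (Num.max 0 (y - x))%:E.
Proof.
have : lebesgue_measure [set` `[x, y]] = (Num.max 0 (y - x))%:E.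
  rewrite lebesgue_measure_itv/= lte_fin; case: ltP => xy; first by rewrite max_r ?subr_ge0// ltW.
  by rewrite max_l ?subr_le0.
exact.
Qed.

Let leb_set1 x : leb [set x] = 0%E.
Proof. exact: lebesgue_measure_set1. Qed.

Hypothesis Lneg : forall S : set R, leb.-negligible S ->
  leb.-negligible [set s | exists t, a <= t <= b /\ u t = s /\ S (w t)].

(** If w were equal at s and t while u s < u t, the whole interval [u s, u t] would lie over the
    null set {w s}, against [Lneg]. *)
Lemma arclength_factor s t : a <= s <= b -> a <= t <= b -> w s = w t -> u s = u t.
Proof.
wlog st : s t / s <= t.
  move=> H hs ht st; have [|/ltW] := leP s t; first by move=> ?; exact: H.
  by move=> ts; apply/esym; apply: H.
move=> /andP[as_ sb] /andP[at_ tb] wst.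
have ust : u s <= u t by exact: (arclength_le glen).
apply/eqP; rewrite eq_le ust/= leNgt; apply/negP => ust'.
have : leb.-negligible [set w s].
  by apply/negligibleP => //; exact: lebesgue_measure_set1.
move=> /Lneg; set A := [set s' | _] => nA.
have : leb.-negligible [set` `[u s, u t]].
  apply: negligibleS nA => y /=; rewrite in_itv/= => /andP[h1 h2].
  have u0 : 0 <= u s by have /andP[] := arclength_range ab glen (introT andP (conj as_ sb)).
  have ub : u t <= u b by apply: (arclength_le glen).
  have [r /andP[ar rb] ury] := arclength_surj ab glen gcont
    (introT andP (conj (le_trans u0 h1) (le_trans h2 ub))).
  rewrite -/(u r) in ury.
  (* The parameter r found for y may lie outside [s, t] on a stretch where u is constant; the nearer
     endpoint then replaces it. *)
  have [rs|/ltW sr] := leP r s.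
    exists s; rewrite as_ sb; split=> //; split=> //.
    apply/eqP; rewrite eq_le h1/= -ury; exact: (arclength_le glen).
  have [tr|/ltW rt] := leP t r.
    exists t; rewrite at_ tb; split=> //; split=> //.
    apply/eqP; rewrite eq_le h2 andbT -ury; exact: (arclength_le glen).
  exists r; rewrite ar rb; split=> //; split=> //.
  apply/eqP; rewrite eq_le; apply/andP; split.
    by rewrite wst; exact: (arclength_le hlen).
  exact: (arclength_le hlen).
move=> /(negligibleP leb (measurable_itv _)) H; have := leb_itv (u s) (u t).
rewrite H => /esym/eqP; rewrite eqe max_r ?subr_ge0//.
by rewrite subr_eq0 gt_eqF.
Qed.

Let clamp (r : R) : R := Num.min (Num.max r 0) (w b).

Let wb0 : 0 <= w b.
Proof. by rewrite fine_ge0// len_ge0. Qed.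

Let clamp_range r : 0 <= clamp r <= w b.
Proof. by rewrite le_min le_max lexx orbT wb0 ge_min lexx orbT. Qed.

Let clampE r : 0 <= r <= w b -> clamp r = r.
Proof. by move=> /andP[r0 rb]; rewrite /clamp max_l// min_l. Qed.

(* The inverse of the function L of the paper, extended by constants. *)
Definition Linv (r : R) : R := u (arctime h a b (clamp r)).

Lemma Linv_arclength t : a <= t <= b -> Linv (w t) = u t.
Proof.
move=> tab; have wt := arclength_range ab hlen tab.
have [h1 h2] := arctimeP ab hlen hcont wt.
by rewrite /Linv clampE//; exact: arclength_factor.
Qed.

Lemma Linv_nondecreasing : nondecreasing_fun Linv.
Proof.
move=> r s rs; have : clamp r <= clamp s.
  by rewrite le_min ge_min ge_min lexx orbT andbT ge_max !le_max rs lexx !orbT.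
rewrite le_eqVlt /Linv => /predU1P[->//|].
have [/andP[h1 h1'] h2] := arctimeP ab hlen hcont (clamp_range r).
have [/andP[h3 h3'] h4] := arctimeP ab hlen hcont (clamp_range s).
rewrite -{1}h2 -{1}h4 => H; apply: (arclength_le glen) => //.
rewrite leNgt; apply/negP => /ltW h5.
by move: H; rewrite ltNge (arclength_le hlen).
Qed.

Lemma arclen_param_comp r : 0 <= r <= w b ->
  arclen_param h a b r = f (arclen_param g a b (Linv r)).
Proof.
move=> rb; have [h1 h2] := arctimeP ab hlen hcont rb.
by rewrite /Linv clampE// arclen_param_arclength.
Qed.

(** The length parameters of f o gamma lying over S, hence essentially L(S), written as a preimage
    so that monotonicity of [Linv] gives measurability. *)
Definition Lpull (S : set R) : set R := [set` `[0, w b]] `&` Linv @^-1` S.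

Lemma Lpull_measurable S : measurable S -> measurable (Lpull S).
Proof.
move=> mS; have mI : measurable [set` `[0, w b] : interval R] by exact: measurable_itv.
by apply: (nondecreasing_measurable mI Linv_nondecreasing mI).
Qed.

(** [Lpull S] is covered by open intervals of nearly its measure. Each is lifted to a parameter
    interval of the curve, where [expansion_cover] bounds the part of S above it. *)
Lemma expansion_measure (S : set R) (c : R) : 0 < c -> measurable S ->
  S `<=` [set` `[0, u b]] ->
  (forall s s', S s -> S s' ->
     c * enorm (arclen_param g a b s - arclen_param g a b s') <=
     enorm (f (arclen_param g a b s) - f (arclen_param g a b s'))) ->
  (c%:E * leb S <= leb (Lpull S))%E.
Proof.
move=> c0 mS Sub Sc; apply/lee_addgt0Pr => e' e'0.
(* The interval cover costs e and the errors e / 2^(i+1) cost another e; after multiplication by c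
   the total is e + c e = e'. *)
pose e := e' / (1 + c); have c1 : 0 < 1 + c by rewrite addr_gt0.
have e0 : 0 < e by rewrite divr_gt0.
have mP := Lpull_measurable mS.
have Poo : (leb (Lpull S) < +oo)%E.
  apply: (@le_lt_trans _ _ (leb [set` `[0, w b] : interval R])).
    by apply: le_measure; [exact: mem_set|apply: mem_set; exact: measurable_itv|exact: subIsetl].
  by rewrite leb_itv ltry.
have [F [NF Fe]] := lebesgue_itv_cover Poo e0.
pose T := [set t | a <= t <= b /\ S (u t)].
have Tc x y : T x -> T y -> c * enorm (g x - g y) <= enorm (h x - h y).
  move=> [xab Sx] [yab Sy]; have := Sc _ _ Sx Sy.
  by rewrite !arclen_param_arclength.
pose M i := Num.max 0 ((F i).2 - (F i).1).
have /choice[B BP] i : exists B : set R, [/\ measurable B,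
    (forall t, T t -> (F i).1 < w t < (F i).2 -> B (u t)) &
    (leb B <= (M i / c)%:E + (e / (2 ^ i.+1)%:R)%:E)%E].
  (* The interval clipped to the range [0, w b] of w, so that both ends are attained. *)
  pose al := Num.max 0 (F i).1; pose be := Num.min (w b) (F i).2.
  have ei0 : 0 < e / (2 ^ i.+1)%:R by rewrite divr_gt0// ltr0n expn_gt0.
  have Mi0 : 0 <= M i by rewrite le_max lexx.
  have Di0 : 0 <= M i / c + e / (2 ^ i.+1)%:R.
    by apply: addr_ge0; [apply: divr_ge0 => //; exact: ltW|exact: ltW].
  have [ba|ab'] := ltP be al.
    exists set0; split=> //; last by rewrite measure0 -EFinD lee_fin.
    move=> t [tab _] /andP[h1 h2]; have /andP[h3 h4] := arclength_range ab hlen tab.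
    have : al <= be.
      rewrite le_min !ge_max wb0 (le_trans (ltW h1) h4) (le_trans h3 (ltW h2)).
      by rewrite (ltW (lt_trans h1 h2)).
    by rewrite leNgt ba.
  have al0 : 0 <= al by rewrite le_max lexx.
  have beb : be <= w b by rewrite ge_min lexx.
  have [t1 t1ab wt1] := arclength_surj ab hlen hcont (introT andP (conj al0 (le_trans ab' beb))).
  have [t2 t2ab wt2] := arclength_surj ab hlen hcont (introT andP (conj (le_trans al0 ab') beb)).
  rewrite -/(w t1) in wt1; rewrite -/(w t2) in wt2.
  have in12 t : T t -> (F i).1 < w t < (F i).2 -> al <= w t <= be.
    move=> [tab _] /andP[h1 h2]; have /andP[h3 h4] := arclength_range ab hlen tab.
    by rewrite ge_max le_min h3 h4 !ltW.
  move: t1ab t2ab => /andP[at1 t1b] /andP[at2 t2b].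
  (* With t2 <= t1 monotonicity forces w t1 = w t2, so every relevant t has the same value of u and
     a single point covers. *)
  have [t12|/ltW t21] := leP t1 t2; last first.
    exists [set u t1]; split=> //; last by rewrite leb_set1 -EFinD lee_fin.
    move=> t Tt /(in12 _ Tt) /andP[h1 h2] /=.
    have h3 : w t2 <= w t1 by exact: (arclength_le hlen).
    apply: arclength_factor; [exact: Tt.1|by rewrite at1|].
    apply/eqP; rewrite eq_le; apply/andP; split; last by rewrite wt1.
    by rewrite (le_trans h2)// -wt2.
  have [B [mB BP lB]] := expansion_cover glen hlen c0 ei0 at1 t12 t2b Tc.
  exists B; split=> //.
    move=> t Tt /(in12 _ Tt) /andP[h1 h2].
    (* A point t outside [t1, t2] with w t in range shares its w-value, hence its u-value, with an
       endpoint, which takes its place. *)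
    have [tt1|/ltW t1t] := leP t t1.
      have -> : u t = u t1.
        apply: arclength_factor; [exact: Tt.1|by rewrite at1|].
        apply/eqP; rewrite eq_le wt1 h1 andbT -wt1; apply: (arclength_le hlen) => //.
        by have /andP[] := Tt.1.
      apply: BP; last by rewrite lexx t12.
      split; first by rewrite at1.
      have <- : u t = u t1; last exact: Tt.2.
      apply: arclength_factor; [exact: Tt.1|by rewrite at1|].
      apply/eqP; rewrite eq_le wt1 h1 andbT -wt1; apply: (arclength_le hlen) => //.
      by have /andP[] := Tt.1.
    have [t2t|/ltW tt2] := leP t2 t.
      have E : u t = u t2.
        apply: arclength_factor; [exact: Tt.1|by rewrite at2|].
        apply/eqP; rewrite eq_le wt2 h2 /= -wt2; apply: (arclength_le hlen) => //.
        by have /andP[] := Tt.1.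
      rewrite E; apply: BP; last by rewrite t12 lexx.
      by split; [rewrite at2|rewrite -E; exact: Tt.2].
    by apply: BP => //; rewrite t1t.
  apply: (le_trans lB); rewrite -EFinD lee_fin addrC lerD2r ler_pM2r ?invr_gt0//.
  rewrite -/(w t1) -/(w t2) wt1 wt2 /M le_max; apply/orP; right.
  by apply: lerB; [rewrite ge_min lexx orbT|rewrite le_max lexx orbT].
have SB : S `<=` \bigcup_i B i.
  move=> s Ss; have sub := Sub s Ss; rewrite /= in_itv/= in sub.
  have [h1 h2] := arctimeP ab glen gcont sub; set t := arctime g a b s in h1 h2.
  have /NF[i _ Fi] : Lpull S (w t).
    by split; rewrite /= ?in_itv/= ?arclength_range// Linv_arclength// /u h2.
  exists i => //; rewrite -h2; have [_ + _] := BP i; apply => //.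
  by split=> //; rewrite /u h2.
have h1 : (leb S <= \sum_(i <oo) ((M i / c)%:E + (e / (2 ^ i.+1)%:R)%:E))%E.
  have mB i : measurable (B i) by have [] := BP i.
  apply: (le_trans (measure_sigma_subadditive leb mB mS SB)).
  by apply: lee_nneseries => // i _; have [] := BP i.
have h2 : (leb S <= c^-1%:E * (leb (Lpull S) + e%:E) + e%:E)%E.
  apply: (le_trans h1); apply: (le_trans (epsilon_trick _ _ (ltW e0))).
    by move=> i; rewrite lee_fin divr_ge0 ?(ltW c0)// le_max lexx.
  apply: leeD2r.
  under eq_eseriesr do rewrite mulrC EFinM.
  rewrite nneseriesZl; last by move=> i _; rewrite lee_fin le_max lexx.
  by apply: lee_wpmul2l => //; rewrite lee_fin invr_ge0 ltW.
apply: (@le_trans _ _ (c%:E * (c^-1%:E * (leb (Lpull S) + e%:E) + e%:E))%E).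
  by apply: lee_wpmul2l => //; rewrite lee_fin ltW.
have Pfin : leb (Lpull S) \is a fin_num by rewrite ge0_fin_numE.
rewrite -(fineK Pfin) -!(EFinD, EFinM) lee_fin.
rewrite mulrDr mulVKf ?gt_eqF// -addrA lerD2l.
rewrite (_ : e + c * e = e')// /e; field.
by rewrite gt_eqF.
Qed.

End curve_comparison.

(** * Comparison of line integrals along gamma and f o gamma *)

Section line_integral_comparison.
Variables (R : realType) (n : nat).
Local Notation V := 'rV[R]_n.+1.
Local Notation BV := (g_sigma_algebraType [set U : set V | open U]).
Variables (f : V -> V) (g : R -> V) (a b : R) (D : set V).
Let h : R -> V := f \o g.
Hypotheses (oD : open D) (cf : {in D, continuous f}).
Hypotheses (ab : a <= b) (gD : forall t, a <= t <= b -> D (g t)).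
Hypotheses (glen : (len g a b < +oo)%E) (gcont : cont_on g a b).
Hypotheses (hlen : (len h a b < +oo)%E) (hcont : cont_on h a b).

Let u t := fine (len g a t).
Let w t := fine (len h a t).
Let leb : {measure set (measurableTypeR R) -> \bar R} := @lebesgue_measure R.

Hypothesis Lneg : forall S : set R, leb.-negligible S ->
  leb.-negligible [set s | exists t, a <= t <= b /\ u t = s /\ S (w t)].

Let gamma := arclen_param g a b.
Let pull := Lpull f g a b.
Let Iu : set R := [set` `[0, u b]].
Let Iw : set R := [set` `[0, w b]].

Let mIu : measurable Iu. Proof. exact: measurable_itv. Qed.
Let mIw : measurable Iw. Proof. exact: measurable_itv. Qed.

(** Expansion holds only within one piece, so S is cut along the disjointified pieces. Their
    pullbacks under [Linv] are again disjoint, and the estimates add up. *)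
Lemma low_set_measure (S : set R) (l : R) : 0 < l -> measurable S -> S `<=` Iu ->
  (forall s, S s -> low_set f D l (gamma s)) ->
  (l%:E * leb S <= leb (pull S))%E.
Proof.
move=> l0 mS SI Sl.
pose F k : set V := if @choice.unpickle (low_index n) k is Some i then
  (if `[< l < ratr i.2 >] then low_piece f D i else set0) else set0.
have mF k : @measurable _ BV (F k).
  rewrite /F; case: (choice.unpickle _) => [i|]; last exact: measurable0.
  by case: ifP => _; [exact: low_piece_borel|exact: measurable0].
have mG k : @measurable _ BV (seqDU F k).
  by rewrite /seqDU; apply: (@measurableD _ BV) => //; exact: bigsetU_measurable.
pose T k := S `&` gamma @^-1` (seqDU F k).
have TE k : T k = S `&` (Iu `&` gamma @^-1` (seqDU F k)) by rewrite setIA (setIidl SI).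
have mT k : measurable (T k).
  by rewrite TE; apply: measurableI => //; exact: arclen_param_borel.
have ST : S = \bigcup_k T k.
  rewrite -setI_bigcupr -preimage_bigcup -seqDU_bigcup_eq; apply/esym/setIidPl => s Ss.
  have [i /= li xi] := Sl s Ss; exists (choice.pickle i) => //.
  by rewrite /F choice.pickleK asboolT.
have tT : trivIset setT T.
  apply/trivIsetP => i j _ _ ij; rewrite -subset0 => s [[_ si] [_ sj]].
  have /trivIsetP/(_ i j I I ij) := trivIset_seqDU F.
  by rewrite -subset0 => H; exact: (H (gamma s) (conj si sj)).
have pT : pull S = \bigcup_k pull (T k).
  by rewrite {1}ST /pull /Lpull preimage_bigcup setI_bigcupr.
have mpT k : measurable (pull (T k)) by apply: Lpull_measurable.
have tpT : trivIset setT (fun k => pull (T k)).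
  apply/trivIsetP => i j _ _ ij; rewrite -subset0 => r [[_ ri] [_ rj]].
  have /trivIsetP/(_ i j I I ij) := tT; rewrite -subset0 => H; exact: (H _ (conj ri rj)).
have -> : leb (pull S) = (\sum_(k <oo) leb (pull (T k)))%E.
  rewrite pT measure_semi_bigcup; [by []|exact: mpT|exact: tpT|].
  by apply: bigcup_measurable => k _; exact: mpT.
apply: (@le_trans _ _ (l%:E * \sum_(k <oo) leb (T k))%E).
  apply: lee_wpmul2l; first by rewrite lee_fin ltW.
  rewrite {1}ST measure_semi_bigcup; [by []|exact: mT|exact: tT|].
  by apply: bigcup_measurable => k _; exact: mT.
rewrite -nneseriesZl//; apply: lee_nneseries => [k _ _|k _].
  by rewrite mule_ge0// lee_fin ltW.
apply: expansion_measure => //; first by move=> s [/SI].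
move=> s s' [Ss ss] [Ss' ss'].
move: (subset_seqDU ss) (subset_seqDU ss'); rewrite /F.
case: (choice.unpickle _) => [i|//]; case: ifPn => [/asboolP li|//].
move=> [Os sP] [Os' _]; have := sP _ Os'; rewrite /Psi_exp subr_ge0 => H.
by apply: le_trans H; rewrite ler_wpM2r ?enorm_ge0// ltW.
Qed.

(** Both integrals are compared with series: rho is at most p_i on A_i, rho' is at least c_i on
    f(A_i), and the length over A_i grows by the factor l_i at least, with p_i <= c_i l_i. *)
Lemma lint_closed_le (A : nat -> set V) (p c l : nat -> R) (Z Z' : set V)
    (rho rho' : V -> \bar R) :
  (forall i, @measurable _ BV (A i)) -> trivIset setT A ->
  (forall i, [/\ 0 <= p i, 0 <= c i, 0 < l i & p i <= c i * l i]) ->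
  (forall i, A i `<=` low_set f D (l i)) ->
  @measurable _ BV Z -> @measurable _ BV Z' ->
  (forall x, D x -> Z x -> Z' (f x)) ->
  (forall x, (0 <= rho x)%E) -> borel_fun rho ->
  (forall x, (0 <= rho' x)%E) -> borel_fun rho' ->
  (forall i x, A i x -> (rho x <= (p i)%:E)%E) ->
  (forall x, D x -> ~ Z x -> (forall i, ~ A i x) -> rho x = 0%E) ->
  (forall i x, A i x -> ((c i)%:E <= rho' (f x))%E) ->
  (forall y, Z' y -> rho' y = +oo%E) ->
  (lint_closed rho g a b <= lint_closed rho' h a b)%E.
Proof.
move=> mA tA pcl Al mZ mZ' ZZ' r0 br r0' br' rp r00 rc rZ'.
pose eta := arclen_param h a b.
rewrite /lint_closed -/(w b) -/(u b) -/Iu -/Iw -/gamma -/eta.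
have mrho : measurable_fun Iu (fun s => rho (gamma s)) by exact: arclen_param_measurable_fun.
have mrho' : measurable_fun Iw (fun r => rho' (eta r)) by exact: arclen_param_measurable_fun.
have mNZ : measurable (Iw `&` eta @^-1` Z') by exact: arclen_param_borel.
(* If f o gamma spends positive length in Z', the right side is +oo. Otherwise [Lneg] shows that
   gamma meets Z in length zero. *)
have [NZ0|NZ0] := eqVneq (leb (Iw `&` eta @^-1` Z')) 0%E; last first.
  suff -> : (\int[lebesgue_measure]_(r in Iw) rho' (eta r) = +oo)%E by rewrite leey.
  apply/eqP; rewrite -leye_eq.
  apply: (@le_trans _ _ (\int[leb]_(r in Iw `&` eta @^-1` Z') rho' (eta r))%E); last first.
    by apply: ge0_subset_integral => //; exact: subIsetl.
  rewrite (eq_integral (cst +oo%E)); last by move=> r /set_mem[_ /rZ'].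
  by rewrite integral_cst// gt0_mulye// lt0e NZ0 measure_ge0.
have mSZ : measurable (Iu `&` gamma @^-1` Z) by exact: arclen_param_borel.
have uI s : Iu s -> 0 <= s <= u b by rewrite /Iu /= in_itv.
have gammaD s : Iu s -> D (gamma s).
  by move=> /uI su; have [] := arctimeP ab glen gcont su => h1 _; exact: gD.
have SZ0 : leb (Iu `&` gamma @^-1` Z) = 0%E.
  apply/(negligibleP leb mSZ).
  have nZ : leb.-negligible (Iw `&` eta @^-1` Z') by apply/(negligibleP leb mNZ).
  apply: negligibleS (Lneg nZ) => s [Is sZ] /=.
  have [h1 h2] := arctimeP ab glen gcont (uI s Is).
  exists (arctime g a b s); split=> //; split=> //.
  split; first by rewrite /Iw /= in_itv/= arclength_range.
  rewrite /= /eta arclen_param_arclength//.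
  by apply: ZZ'; [exact: gD|exact: sZ].
pose S i := Iu `&` gamma @^-1` (A i).
have mS i : measurable (S i) by exact: arclen_param_borel.
have SI i : S i `<=` Iu by exact: subIsetl.
pose N i := pull (S i).
have mN i : measurable (N i) by exact: Lpull_measurable.
have key i : ((p i)%:E * leb (S i) <= (c i)%:E * leb (N i))%E.
  have [p0 c0 l0 pc] := pcl i.
  have : ((l i)%:E * leb (S i) <= leb (N i))%E.
    by apply: low_set_measure => // s [_ /Al].
  have ci : (0 <= (c i)%:E)%E by rewrite lee_fin.
  move=> /(lee_wpmul2l ci); apply: le_trans; rewrite muleA -EFinM.
  by apply: lee_wpmul2r => //; rewrite lee_fin.
have indS (q : nat -> R) (X : nat -> set R) (I : set R) :
    measurable I -> (forall i, measurable (X i)) ->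
    (forall i, X i `<=` I) -> (forall i, 0 <= q i) ->
    (\int[leb]_(s in I) (\sum_(i <oo) (q i * \1_(X i) s)%:E) =
     \sum_(i <oo) ((q i)%:E * leb (X i)))%E.
  move=> mI mX XI q0; rewrite integral_nneseries//; last 2 first.
  - move=> i; apply/measurable_EFinP; apply: measurable_funM => //.
    by apply: measurable_indic; exact: mX.
  - by move=> i x _; rewrite lee_fin mulr_ge0// indicE.
  apply: eq_eseriesr => i _.
  rewrite (@integralZl_indic _ _ _ leb I mI (fun=> X i) (q i) _ (mX i)); last by rewrite ltNge q0.
  rewrite integral_indic//; last exact: mX.
  by apply: (congr1 (fun B => (q i)%:E * leb B)%E); exact/setIidl/XI.
have msum (q : nat -> R) (X : nat -> set R) (I : set R) : (forall i, measurable (X i)) ->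
    (forall i, 0 <= q i) ->
    measurable_fun I (fun s => \sum_(i <oo) (q i * \1_(X i) s)%:E)%E.
  move=> mX q0; apply: ge0_emeasurable_sum => [i x _ _|i _].
    by rewrite lee_fin mulr_ge0// indicE.
  apply/measurable_EFinP; apply: measurable_funM => //.
have sum0 (q : nat -> R) (X : nat -> set R) s : (forall i, 0 <= q i) ->
    (0 <= \sum_(i <oo) (q i * \1_(X i) s)%:E)%E.
  by move=> q0; apply: nneseries_ge0 => i _ _; rewrite lee_fin mulr_ge0// indicE.
have p0 i : 0 <= p i by have [] := pcl i.
have c0 i : 0 <= c i by have [] := pcl i.
apply: (@le_trans _ _ (\sum_(i <oo) ((p i)%:E * leb (S i)))%E).
  rewrite -(indS p S Iu)//.
  (* The series dominates rho only off Z, hence the almost everywhere form. *)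
  apply: ae_ge0_le_integral; [exact: mIu|by []|exact: mrho|by move=> x _; exact: sum0|exact: msum|].
  exists (Iu `&` gamma @^-1` Z); split=> // s /= /not_implyP[Is sP]; split=> //.
  apply: contrapT => nZ; apply: sP.
  have [[i Ai]|nA] := pselect (exists i, A i (gamma s)); last first.
    rewrite r00//; [exact: sum0|exact: gammaD|].
    by move=> i Ai; apply: nA; exists i.
  apply: (le_trans (rp i _ Ai)).
  rewrite (nneseries_split 0%N i.+1); last by move=> k _; rewrite lee_fin mulr_ge0// indicE.
  rewrite add0n big_nat_recr//= [\1_(S i) s]indicE mem_set ?mulr1; last by split.
  rewrite -[leLHS]add0e -[leLHS]adde0; apply: leeD.
    by apply: leeD => //; apply: sume_ge0 => k _; rewrite lee_fin mulr_ge0// indicE.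
  by apply: nneseries_ge0 => k _ _; rewrite lee_fin mulr_ge0// indicE.
apply: (@le_trans _ _ (\sum_(i <oo) ((c i)%:E * leb (N i)))%E).
  by apply: lee_nneseries => // i _ _; rewrite mule_ge0// lee_fin.
have NI i : N i `<=` Iw by exact: subIsetl.
rewrite -(indS c N Iw)//.
apply: ge0_le_integral; [exact: mIw|by move=> x _; exact: sum0|exact: msum|exact: mrho'|].
move=> r Ir; have [[i Ni]|nN] := pselect (exists i, N i r); last first.
  rewrite eseries0// => i _ _; rewrite indicE memNset ?mulr0// => Ni.
  by apply: nN; exists i.
have Ar : A i (gamma (Linv f g a b r)) by have [_ []] := Ni.
have er : eta r = f (gamma (Linv f g a b r)).
  by apply: arclen_param_comp => //; move: Ir; rewrite /Iw/= in_itv.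
rewrite er; apply: le_trans (rc i _ Ar).
rewrite (nneseries_split 0%N i.+1); last by move=> k _; rewrite lee_fin mulr_ge0// indicE.
(* Disjointness of the [A i] leaves a single nonzero term of the series at r. *)
have z k : k != i -> \1_(N k) r = 0 :> R.
  move=> ki; rewrite indicE memNset// => -[_ [_ Ak]].
  have /trivIsetP/(_ k i I I ki) := tA; rewrite -subset0 => H; exact: (H _ (conj Ak Ar)).
rewrite add0n eseries0 ?adde0; last first.
  by move=> k ik _; rewrite z ?mulr0// gtn_eqF.
rewrite big_nat_recr//= big_nat_cond big1 ?add0e.
  by rewrite lee_fin ler_piMr// indicE lern1 leq_b1.
by move=> k /andP[/andP[_ ki] _]; rewrite z ?mulr0// ltn_eqF.
Qed.

End line_integral_comparison.

(** * The modulus inequality *)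

Section null_sets.
Variables (R : realType) (n : nat).
Local Notation V := 'rV[R]_n.+1.
Variables (f : V -> V) (D : set V).
Hypotheses (oD : open D) (cf : {in D, continuous f}).

Lemma mstar_bigcup_null (F : nat -> set V) :
  (forall k, mstar (F k) = 0%E) -> mstar (\bigcup_k F k) = 0%E.
Proof.
move=> F0; apply/eqP; rewrite eq_le mstar_ge0 andbT.
by rewrite (le_trans (mstar_sigma_subadditive F))// eseries0.
Qed.

Lemma mstar_null_subset (A B : set V) : A `<=` B -> mstar B = 0%E -> mstar A = 0%E.
Proof. by move=> AB B0; apply/eqP; rewrite eq_le mstar_ge0 -{1}B0 le_mstar. Qed.

Lemma jac0_null : Ninv_prop D f ->
  mstar [set x | [/\ D x, differentiable f x & jac f x = 0]] = 0%E.
Proof.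
move=> Nf; set S := [set x | _].
have fS0 : mstar (f @` S) = 0%E.
  pose Q k : set V := S `&` box (const_mx (- k%:R)) (const_mx k%:R).
  apply: (@mstar_null_subset _ (\bigcup_k f @` Q k)).
    move=> _ [x Sx <-]; exists (Num.truncn (`|x|)).+1 => //; exists x => //; split=> // i.
    rewrite !mxE -ler_norml (le_trans (le_coord_norm x i))// ltW//.
    exact: truncnS_gt.
  apply: mstar_bigcup_null => k; apply/eqP; rewrite eq_le mstar_ge0 andbT.
  pose v := box_vol (const_mx (- k%:R) : V) (const_mx k%:R).
  have v0 : 0 <= v by exact: box_vol_ge0.
  apply/lee_addgt0Pr => e e0; rewrite add0e.
  (* Where J = 0 every positive M is allowed; this one makes M v at most e, with + 1 for the case v
     = 0. *)
  have M0 : 0 < e / (v + 1) by rewrite divr_gt0// ltr_wpDl.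
  apply: (@le_trans _ _ ((e / (v + 1))%:E * mstar (Q k))%E).
    apply: (@up_set_measure _ _ f D oD cf) => x [[Dx dx Jx] _].
    by apply: up_set_intro => //; rewrite Jx normr0.
  apply: (@le_trans _ _ ((e / (v + 1))%:E * v%:E)%E).
    apply: lee_wpmul2l; first by rewrite lee_fin ltW.
    by apply: le_trans (mstar_box _ _); apply: le_mstar => x [].
  rewrite -EFinM lee_fin mulrAC ler_pdivrMr ?ltr_wpDl// ler_pM2l// lerDl//.
have := Nf _ fS0; apply: mstar_null_subset => x Sx; split; first by have [] := Sx.
by exists x.
Qed.

End null_sets.

Section curves.
Variables (R : realType) (n : nat).
Local Notation V := 'rV[R]_n.+1.
Implicit Types (f : V -> V) (D : set V) (g : curve R n.+1).

Lemma within_open_continuous f D : open D -> {within D, continuous f} ->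
  {in D, continuous f}.
Proof.
by move=> oD; rewrite -continuous_open_subspace// continuous_subspace_in.
Qed.

Lemma interval_between (I : interval R) a b t :
  a \in I -> b \in I -> a <= t <= b -> t \in I.
Proof. by move=> aI bI /andP[at_ tb]; apply: (@interval_is_interval _ I a b); rewrite ?at_. Qed.

Lemma curve_cont_on g a b : is_curve g -> a \in cI g -> b \in cI g ->
  cont_on (cf g) a b.
Proof.
move=> cg aI bI s sab e e0.
have sI := interval_between aI bI sab.
have /subspace_continuousP/(_ s sI) := cg.
have n1 : 0 < n.+1%:R :> R by [].
move=> /cvgrPdist_lt/(_ (e / n.+1%:R) (divr_gt0 e0 n1)).
rewrite /within/= => /nbhs_ballP[d /= d0 dP]; exists d => // t tab ts.
have := dP t; rewrite /ball/= distrC => /(_ ts (interval_between aI bI tab)).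
rewrite distrC ltr_pdivlMr// mulrC; apply: le_lt_trans; exact: enorm_le_norm.
Qed.

Lemma curve_in_fcurve f D g : {in D, continuous f} -> curve_in D g ->
  curve_in (f @` D) (fcurve f g).
Proof.
move=> contf [cg gD]; split; last by move=> t tI; exists (cf g t) => //; exact: gD.
apply/subspace_continuousP => s sI; have /subspace_continuousP/(_ s sI) cgs := cg.
have /contf fs : cf g s \in D by apply: mem_set; exact: gD.
exact: (cvg_comp _ _ cgs fs).
Qed.

(** With base point a, the signed length on [a, b] is the plain one. *)
Lemma L_Ninv_negligible f g a b : L_Ninv f g -> a \in cI g -> b \in cI g ->
  forall S : set R, (@lebesgue_measure R).-negligible S ->
  (@lebesgue_measure R).-negligible [set s | exists t, a <= t <= b /\
    fine (len (cf g) a t) = s /\ S (fine (len (f \o cf g) a t))].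
Proof.
move=> LN aI bI S nS; apply: negligibleS (LN a aI S nS) => s [t [tab [ts St]]].
exists t; split; first exact: interval_between tab.
by rewrite /slen; have /andP[-> _] := tab.
Qed.

Lemma le_lint g (rho rho' : V -> \bar R) : is_curve g -> loc_rect g ->
  (forall x, (0 <= rho x)%E) -> borel_fun rho -> borel_fun rho' ->
  (forall x, (rho x <= rho' x)%E) -> (lint rho g <= lint rho' g)%E.
Proof.
move=> cg lg r0 br br' rr'; apply: ge_ereal_sup => _ [a [b [aI [bI [ab ->]]]]].
apply: (@le_trans _ _ (lint_closed rho' (cf g) a b)); last first.
  by apply: ereal_sup_ubound; exists a, b.
have gl := lg a b aI bI ab; have gc := curve_cont_on cg aI bI.
apply: ge0_le_integral; [exact: measurable_itv|by []| | |by []].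
- exact: (arclen_param_measurable_fun ab gl gc).
- exact: (arclen_param_measurable_fun ab gl gc).
Qed.

Lemma KIq_regular (q : R) f x : differentiable f x -> jac f x != 0 ->
  KIq q f x = (`|jac f x| / lmin f x `^ q)%:E.
Proof. by move=> dfx Jx; rewrite /KIq asboolT// Jx. Qed.

End curves.

Section main.
Variables (R : realType) (n : nat).
Local Notation V := 'rV[R]_n.+1.
Local Notation BV := (g_sigma_algebraType [set U : set V | open U]).
Variables (D : set V) (f : V -> V) (q : R).
Hypotheses (oD : open D) (q1 : 1 <= q) (contf : {in D, continuous f}).
Hypotheses (fdiff : diff_ae D f) (fN : N_prop D f) (fNinv : Ninv_prop D f).
Variables (G : set (curve R n.+1)) (rho : V -> \bar R).
Hypotheses (GD : forall g, G g -> curve_in D g) (admrho : adm G rho).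

Let K x : \bar R := (KIq q f x * (rho x `^ q))%E.

Let q0 : 0 < q. Proof. exact: lt_le_trans q1. Qed.

Let rho0 x : (0 <= rho x)%E. Proof. exact: admrho.1. Qed.

Lemma mint_ge_cst (E : set V) (c : R) : 0 <= c -> lmeasurable E -> E `<=` D ->
  (forall x, E x -> (c%:E <= K x)%E) -> (c%:E * mstar E <= mint D K)%E.
Proof.
move=> c0 mE ED cK; apply: ereal_sup_ubound.
exists 1%N, (fun=> c), (fun=> E); split=> //; split=> //; split=> //; split.
  by move=> i j; rewrite !ord1 eqxx.
by split=> //; rewrite big_ord1.
Qed.

(* Outside a Borel null set f is differentiable with nonzero Jacobian and,
   the right-hand side being finite, rho is finite. *)
Lemma exceptional_set : (mint D K < +oo)%E ->
  exists Z : set V, [/\ @measurable _ BV Z, mstar Z = 0%E &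
    forall x, D x -> ~ Z x -> [/\ differentiable f x, jac f x != 0 & rho x != +oo%E]].
Proof.
move=> Koo.
pose E := [set x | D x /\ ~ differentiable f x] `|`
          [set x | [/\ D x, differentiable f x & jac f x = 0]].
have E0 : mstar E = 0%E.
  apply/eqP; rewrite eq_le mstar_ge0 andbT.
  apply: (le_trans (outer_measureU2 (@mstar R n.+1) _ _)).
  rewrite [X in (X + _)%E](fdiff : mstar _ = 0%E).
  by rewrite [X in (_ + X)%E](jac0_null oD contf fNinv : mstar _ = 0%E) adde0.
have [Z1 [mZ1 EZ1 Z1E]] := borel_envelope E.
have Z10 : mstar Z1 = 0%E by apply/eqP; rewrite eq_le mstar_ge0 -{1}E0 Z1E.
have reg x : D x -> ~ Z1 x -> differentiable f x /\ jac f x != 0.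
  move=> Dx nZ; have dx : differentiable f x.
    by apply: contrapT => ndx; apply/nZ/EZ1; left.
  by split=> //; apply/eqP => Jx; apply/nZ/EZ1; right.
pose Z2 := (D `&` rho @^-1` [set +oo%E]) `\` Z1.
have mZ2 : @measurable _ BV Z2.
  apply: measurableD => //; apply: measurableI; first exact: open_borel.
  exact: admrho.2.1.
have KZ2 x : Z2 x -> K x = +oo%E.
  move=> [[Dx rx] nZ]; have [dx Jx] := reg x Dx nZ.
  rewrite /K (KIq_regular _ dx Jx) (rx : rho x = +oo%E) poweRyr ?gt_eqF// gt0_muley//.
  by rewrite lte_fin divr_gt0 ?normr_gt0// powR_gt0// lmin_gt0.
have Z20 : mstar Z2 = 0%E.
  have H c : 0 <= c -> (c%:E * mstar Z2 <= mint D K)%E.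
    move=> c0; apply: mint_ge_cst => //; first exact: borel_lmeasurable.
      by move=> x [[]].
    by move=> x /KZ2 ->; rewrite leey.
  apply/eqP/negPn/negP => Z2n.
  have Z2gt : (0 < mstar Z2)%E by rewrite lt0e Z2n mstar_ge0.
  have Kfin : mint D K \is a fin_num.
    rewrite ge0_fin_numE//; have := H 0 (lexx _); rewrite mul0e//.
  have := H 1 ler01; rewrite mul1e => Z2K.
  have Z2fin : mstar Z2 \is a fin_num.
    by rewrite ge0_fin_numE ?mstar_ge0//; exact: le_lt_trans Koo.
  move: Z2gt H Kfin; rewrite -(fineK Z2fin) lte_fin => m0 H Kfin.
  have k0 : 0 <= fine (mint D K).
    by rewrite -lee_fin fineK//; have := H 0 (lexx _); rewrite mul0e.
  (* For this c the lower bound c m(Z2) equals [mint D K] + 1, a contradiction. *)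
  have c0 : 0 <= (fine (mint D K) + 1) / fine (mstar Z2).
    by apply: divr_ge0; [rewrite addr_ge0|exact: ltW].
  have := H _ c0.
  rewrite -(fineK Kfin) -EFinM lee_fin divfK ?gt_eqF//; lra.
exists (Z1 `|` Z2); split; first exact: measurableU.
  apply/eqP; rewrite eq_le mstar_ge0 andbT.
  apply: (le_trans (outer_measureU2 (@mstar R n.+1) _ _)).
  by rewrite [X in (X + _)%E](Z10 : mstar _ = 0%E) [X in (_ + X)%E](Z20 : mstar _ = 0%E) adde0.
move=> x Dx nZ; have nZ1 : ~ Z1 x by move=> ?; apply: nZ; left.
have [dx Jx] := reg x Dx nZ1; split=> //; apply/eqP => rx.
by apply: nZ; right.
Qed.

(* Here rho, |J| and l(f') are known up to the factor t. *)
Definition level_set (t : R) (Z : set V) (p j l : R) : set V :=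
  (D `\` Z) `&` rho @^-1` [set` `[p%:E, (t * p)%:E]] `&`
  (up_set f D (t * j) `\` up_set f D j) `&`
  (low_set f D l `\` low_set f D (t * l)).

Lemma level_set_borel t Z p j l : @measurable _ BV Z ->
  @measurable _ BV (level_set t Z p j l).
Proof.
move=> mZ; apply: measurableI; last first.
  by apply: measurableD; exact: low_set_borel.
apply: measurableI; last by apply: measurableD; exact: up_set_borel.
apply: measurableI; first by apply: measurableD => //; exact: open_borel.
by apply: admrho.2.1; exact: emeasurable_itv.
Qed.

Lemma rat_below (t y : R) : 1 < t -> 0 < y ->
  exists r : rat, [/\ 0 < ratr r :> R, ratr r < y & y < t * ratr r].
Proof.
move=> t1 y0; have t0 : 0 < t by exact: lt_trans t1.
have yt : y / t < y by rewrite ltr_pdivrMr// ltr_pMr.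
have [r] := rat_in_itvoo yt; rewrite in_itv/= => /andP[h1 h2]; exists r.
split=> //; first by apply: lt_trans h1; rewrite divr_gt0.
by move: h1; rewrite ltr_pdivrMr// mulrC.
Qed.

Lemma modulus_slack (t eps : R) : 1 < t -> 0 < eps -> (mint D K < +oo)%E ->
  L2_prop q D f ->
  (modulus q (fam_image f G) <= (t `^ (2 * q + 1))%:E * mint D K + eps%:E)%E.
Proof.
move=> t1 eps0 Koo [G0 [G00 HL2]].
have t0 : 0 < t by exact: lt_trans t1.
have [Z [mZ Z0 Zreg]] := exceptional_set Koo.
have fZ0 : mstar (f @` (D `&` Z)) = 0%E.
  by apply: fN; [exact: subIsetl|apply: mstar_null_subset Z0; exact: subIsetr].
have [Z' [mZ' fZZ' Z'le]] := borel_envelope (f @` (D `&` Z)).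
have Z'0 : mstar Z' = 0%E by apply/eqP; rewrite eq_le mstar_ge0 -{1}fZ0 Z'le.
(* Enumerates the positive rational triples (p, j, l). Other codes give (1, 1, 1); repeated level
   sets are emptied by [seqDU]. *)
pose val (k : nat) : R * R * R :=
  if @choice.unpickle (rat * rat * rat)%type k is Some pjl then
    if [&& 0 < ratr pjl.1.1 :> R, 0 < ratr pjl.1.2 :> R & 0 < ratr pjl.2 :> R]
    then (ratr pjl.1.1, ratr pjl.1.2, ratr pjl.2) else (1, 1, 1)
  else (1, 1, 1).
pose p k := (val k).1.1; pose j k := (val k).1.2; pose l k := (val k).2.
have pos k : [/\ 0 < p k, 0 < j k & 0 < l k].
  rewrite /p /j /l /val; case: (choice.unpickle _) => [pjl|]; last by split; exact: ltr01.
  by case: ifP => [/and3P[? ? ?]|_]; split => //; exact: ltr01.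
have p0 k : 0 < p k by have [] := pos k.
have j0 k : 0 < j k by have [] := pos k.
have l0 k : 0 < l k by have [] := pos k.
pose B k := level_set t Z (p k) (j k) (l k).
have mB k : @measurable _ BV (B k) by exact: level_set_borel.
pose A := seqDU B.
have mA k : @measurable _ BV (A k).
  by rewrite /A /seqDU; apply: (@measurableD _ BV) => //; exact: bigsetU_measurable.
have AB k : A k `<=` B k by exact: subset_seqDU.
have Acover x : D x -> ~ Z x -> (forall k, ~ A k x) -> rho x = 0%E.
  move=> Dx nZx nA; apply: contrapT => /eqP rx0.
  have [dx Jx rxoo] := Zreg x Dx nZx.
  have rfin : rho x \is a fin_num by rewrite ge0_fin_numE ?rho0// ltey.
  have r0 : 0 < fine (rho x) by rewrite fine_gt0// lt0e rx0 rho0 ltey.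
  have J0 : 0 < `|jac f x| by rewrite normr_gt0.
  have [rp [rp0 rp1 rp2]] := rat_below t1 r0.
  have [rj [rj0 rj1 rj2]] := rat_below t1 J0.
  have [rl [rl0 rl1 rl2]] := rat_below t1 (lmin_gt0 Jx).
  have : (\bigcup_k A k) x.
    rewrite /A -seqDU_bigcup_eq; exists (choice.pickle (rp, rj, rl)) => //.
    rewrite /B /p /j /l /val choice.pickleK /= rp0 rj0 rl0 /=.
    split; last first.
      split; first by apply/low_setP.
      by move/(low_setP oD _ Dx dx); rewrite ltNge (ltW rl2).
    split; last first.
      split; first by apply/up_setP.
      by move/(up_setP oD _ Dx dx); rewrite ltNge (ltW rj1).
    split; first by split.
    by rewrite /= in_itv/= -(fineK rfin) !lee_fin (ltW rp1) (ltW rp2).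
  by move=> [k _]; exact: nA.
(* On [A k], rho <= t p and l(f') >= l, so [c k] bounds rho / l(f') from above; [d k] bounds K from
   below through |J| >= j, l(f') <= t l and rho >= p. *)
pose c k := t * p k / l k.
pose d k := j k / (t * l k) `^ q * p k `^ q.
have c0 k : 0 < c k by rewrite divr_gt0// mulr_gt0.
have d0 k : 0 <= d k by rewrite mulr_ge0 ?powR_ge0// divr_ge0 ?powR_ge0// ltW.
have cd k : c k `^ q * (t * j k) = t `^ (2 * q + 1) * d k.
  have tl0 : 0 < t * l k by rewrite mulr_gt0.
  have cE : c k * (t * l k) = (t * t) * p k.
    by rewrite /c; move: (l k) (l0 k) (p k) => lk lk0 pk; field; rewrite gt_eqF.
  have : c k `^ q * (t * l k) `^ q = (t * t) `^ q * p k `^ q.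
    rewrite -(powRM _ (ltW (c0 k)) (ltW tl0)) cE powRM ?(ltW (p0 k))//.
    by rewrite mulr_ge0 ?(ltW t0).
  have tlq : 0 < (t * l k) `^ q by rewrite powR_gt0.
  move=> E; rewrite /d powRD; last by rewrite (gt_eqF t0) implybT.
  rewrite powRr1 ?(ltW t0)// (_ : t `^ (2 * q) = (t * t) `^ q); last first.
    by rewrite powRrM -[t `^ 2]/(t `^ 2%:R) powR_mulrn ?(ltW t0)// expr2.
  apply: (@mulIf _ ((t * l k) `^ q)); first by rewrite gt_eqF.
  rewrite mulrAC E; move: ((t * l k) `^ q) ((t * t) `^ q) (p k `^ q) (j k) tlq => X Y P jk X0.
  by field; rewrite gt_eqF.
have dK k x : A k x -> ((d k)%:E <= K x)%E.
  move=> /AB [[[[Dx nZx] rx] [_ jx]] [_ lx]].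
  have [dx Jx rxoo] := Zreg x Dx nZx.
  have rfin : rho x \is a fin_num by rewrite ge0_fin_numE ?rho0// ltey.
  move: rx; rewrite /= in_itv/= => /andP[pr _].
  have Jj : j k <= `|jac f x|.
    by rewrite leNgt; apply/negP => /(up_setP oD _ Dx dx).
  have ll : lmin f x <= t * l k.
    by rewrite leNgt; apply/negP => /(low_setP oD _ Dx dx).
  rewrite /K (KIq_regular _ dx Jx) -(fineK rfin) poweR_EFin -EFinM lee_fin.
  have lm := lmin_gt0 Jx.
  apply: ler_pM; [by rewrite divr_ge0 ?powR_ge0// ltW|exact: powR_ge0| |].
    apply: ler_pM => //; [exact: ltW|by rewrite invr_ge0 powR_ge0|].
    rewrite lef_pV2 ?posrE ?powR_gt0// ?mulr_gt0//.
    by apply: ge0_ler_powR; rewrite ?nnegrE ?(ltW lm) ?(ltW q0)// mulr_ge0// ltW.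
  have prf : p k <= fine (rho x) by rewrite -lee_fin fineK.
  by apply: ge0_ler_powR; rewrite ?nnegrE ?(ltW q0) ?(ltW (p0 k))// fine_ge0.
have /choice[C CP] k : exists C, [/\ @measurable _ BV C, f @` A k `<=` C &
    (mstar C <= mstar (f @` A k))%E] by exact: borel_envelope.
have mC k : @measurable _ BV (C k) by have [] := CP k.
have Cle k : (mstar (C k) <= (t * j k)%:E * mstar (A k))%E.
  have [_ _ H] := CP k; apply: (le_trans H).
  by apply: (@up_set_measure _ _ f D oD contf) => x /AB[[_ []]].
have [_ [rho1 [[rho10 [brho1 adm1]] ->]] rho1e] : exists2 s,
    [set s | exists r, adm G0 r /\ s = mint setT (fun x => (r x `^ q)%E)] s &
    (s < eps%:E)%E.
  by apply: ereal_inf_lt; rewrite -/(modulus q G0) G00 lte_fin.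
(* The density on the image side is H^(1/q). The sum of q-th powers replaces the
   supremum of the c_k over the sets C_k; rho1 handles the exceptional curves of
   L^(2)_q, and the last term those meeting f(Z) in positive length. *)
pose H x := (rho1 x `^ q + \sum_(k <oo) (c k `^ q * \1_(C k) x)%:E +
             if x \in Z' then +oo else 0)%E.
have s0 x : (0 <= \sum_(k <oo) (c k `^ q * \1_(C k) x)%:E)%E.
  by apply: nneseries_ge0 => k _ _; rewrite lee_fin mulr_ge0 ?powR_ge0// indicE.
have z0 (x : V) : (0 <= if x \in Z' then +oo else 0 :> \bar R)%E by case: ifP.
have H0 x : (0 <= H x)%E by rewrite !adde_ge0 ?poweR_ge0.
pose rho' x := (H x `^ q^-1)%E.
have rho'q x : (rho' x `^ q)%E = H x.
  by rewrite /rho' -poweRrM mulVf ?gt_eqF// poweRe1.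
have rho'0 x : (0 <= rho' x)%E by exact: poweR_ge0.
have le_rho' x y : (0 <= y)%E -> (y `^ q <= H x)%E -> (y <= rho' x)%E.
  move=> y0 yH; have -> : y = ((y `^ q) `^ q^-1)%E by rewrite -poweRrM mulfV ?gt_eqF// poweRe1.
  apply: gt0_ler_poweR => //; first by rewrite invr_ge0 ltW.
    by rewrite in_itv/= poweR_ge0 leey.
  by rewrite in_itv/= H0 leey.
have rho1' x : (rho1 x <= rho' x)%E.
  by apply: le_rho' => //; rewrite /H -addeA leeDl// adde_ge0.
have crho' k y : C k y -> ((c k)%:E <= rho' y)%E.
  move=> Cy; apply: le_rho'; first by rewrite lee_fin ltW.
  rewrite poweR_EFin /H; apply: (@le_trans _ _ (\sum_(k <oo) (c k `^ q * \1_(C k) y)%:E)%E).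
    rewrite (nneseries_split 0%N k.+1); last first.
      by move=> i _; rewrite lee_fin mulr_ge0 ?powR_ge0// indicE.
    rewrite add0n big_nat_recr//= [\1_(C k) y]indicE mem_set// mulr1.
    rewrite -[leLHS]add0e -[leLHS]adde0; apply: leeD.
      by apply: leeD => //; apply: sume_ge0 => i _; rewrite lee_fin mulr_ge0 ?powR_ge0// indicE.
    by apply: nneseries_ge0 => i _ _; rewrite lee_fin mulr_ge0 ?powR_ge0// indicE.
  rewrite -[leLHS]adde0 -[leLHS]add0e addeA.
  by apply: leeD => //; apply: leeD => //; exact: poweR_ge0.
have Zrho' y : Z' y -> rho' y = +oo%E.
  move=> Zy; have h : (0 <= rho1 y `^ q + \sum_(k <oo) (c k `^ q * \1_(C k) y)%:E)%E.
    by rewrite adde_ge0// poweR_ge0.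
  rewrite /rho' /H mem_set// addey; last by rewrite -ltNye (lt_le_trans _ h).
  by rewrite poweRyr// invr_neq0// gt_eqF.
have bpow1 : borel_fun (fun x => rho1 x `^ q)%E.
  apply/borel_fun_measurable; apply: (measurableT_comp (@measurable_poweR R q)).
  exact/borel_fun_measurable.
have brho' : borel_fun rho'.
  apply/borel_fun_measurable; apply: (measurableT_comp (@measurable_poweR R q^-1)).
  apply: emeasurable_funD; last first.
    apply: measurable_fun_ifT => //.
    apply: (@measurable_fun_bool _ BV _ _ true); rewrite setTI.
    by rewrite (_ : _ @^-1` _ = Z')//; apply/seteqP; split=> x /=; [exact: set_mem|exact: mem_set].
  apply: emeasurable_funD; first exact/borel_fun_measurable.
  apply: ge0_emeasurable_sum => [k x _ _|k _].
    by rewrite lee_fin mulr_ge0 ?powR_ge0// indicE.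
  by apply/measurable_EFinP; apply: measurable_funM => //; exact: measurable_indic.
have adm' : adm (fam_image f G) rho'.
  split=> //; split=> // _ [g Gg <-] lfg.
  have [cg gD] := GD Gg; have [cfg fgD] := curve_in_fcurve contf (GD Gg).
  (* For an exceptional image curve [rho1 <= rho'] suffices; otherwise each closed subcurve of g is
     compared with its image. *)
  have [G0g|nG0g] := pselect (G0 (fcurve f g)).
    by apply: (le_trans (adm1 _ G0g lfg)); exact: le_lint.
  have [lg /(_ lfg) LN] := HL2 _ (curve_in_fcurve contf (GD Gg)) nG0g g (GD Gg) erefl.
  apply: (le_trans (admrho.2.2 g Gg lg)).
  apply: ge_ereal_sup => _ [a [b [aI [bI [ab ->]]]]].
  apply: (@le_trans _ _ (lint_closed rho' (f \o cf g) a b)); last first.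
    by apply: ereal_sup_ubound; exists a, b.
  apply: (@lint_closed_le _ _ f (cf g) a b D oD contf ab _ _ _ _ _ _ A
    (fun k => t * p k) c l Z Z' rho rho') => //.
  - by move=> s sab; apply: gD; exact: interval_between sab.
  - exact: lg.
  - exact: curve_cont_on.
  - exact: (lfg a b aI bI ab).
  - exact: (curve_cont_on cfg aI bI).
  - exact: L_Ninv_negligible.
  - exact: trivIset_seqDU.
  - move=> k; split; [by rewrite mulr_ge0// ltW|exact: ltW|exact: l0|].
    by rewrite /c divfK ?gt_eqF.
  - by move=> k x /AB[_ []].
  - by move=> x Dx Zx; apply: fZZ'; exists x.
  - exact: admrho.2.1.
  - by move=> k x /AB[[[_ rx] _] _]; move: rx; rewrite /= in_itv/= => /andP[].
  - by move=> k x Ax; apply: crho'; have [_ + _] := CP k; apply; exists x.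
(* [mint] admits finitely many pieces, so each partial sum is a competitor and the series follows in
   the limit. *)
have Ksum : (\sum_(k <oo) ((d k)%:E * mstar (A k)) <= mint D K)%E.
  apply: lime_le.
    by apply: is_cvg_nneseries => k _ _; rewrite mule_ge0 ?mstar_ge0// lee_fin.
  apply: nearW => N; rewrite big_mkord; apply: ereal_sup_ubound.
  exists N, (fun k => d k), (fun k => A k); split=> //; split.
    by move=> k; apply: borel_lmeasurable; exact: mA.
  split; first by move=> k x /AB[[[[]]]].
  split; last by split=> // k x; exact: dK.
  move=> i k ik; have /trivIsetP := trivIset_seqDU B; apply => //.
apply: (@le_trans _ _ (mint setT (fun x => (rho' x `^ q)%E))).
  by apply: ereal_inf_lbound; exists rho'.
rewrite (_ : (fun x => _) = H); last by apply/funext => x; exact: rho'q.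
apply: (le_trans (mint_series_le _ bpow1 _ mC mZ' Z'0)).
- by move=> x; exact: poweR_ge0.
- by move=> k; exact: powR_ge0.
rewrite addeC; apply: leeD; last exact: ltW.
apply: (@le_trans _ _ (\sum_(k <oo) ((t `^ (2 * q + 1))%:E * ((d k)%:E * mstar (A k))))%E).
  apply: lee_nneseries => [k _ _|k _].
    by rewrite mule_ge0 ?mstar_ge0// lee_fin powR_ge0.
  rewrite muleA -EFinM -cd EFinM -muleA; apply: lee_wpmul2l => //.
  by rewrite lee_fin powR_ge0.
rewrite nneseriesZl; last by move=> k _; rewrite mule_ge0 ?mstar_ge0// lee_fin.
by apply: lee_wpmul2l => //; rewrite lee_fin powR_ge0.
Qed.

Lemma modulus_le : L2_prop q D f -> (modulus q (fam_image f G) <= mint D K)%E.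
Proof.
move=> HL2; have [Koo|Koo] := leP +oo%E (mint D K); first by rewrite (le_trans _ Koo)// leey.
have K0 : (0 <= mint D K)%E.
  apply: ereal_sup_ubound; exists 0%N, (fun=> 0), (fun=> set0).
  do 5 (split; first by case) => //.
  by rewrite big_ord0.
have Kfin : mint D K \is a fin_num by rewrite ge0_fin_numE.
pose k := fine (mint D K); have k0 : 0 <= k by rewrite fine_ge0.
apply/lee_addgt0Pr => e e0.
(* T will be t^(2q+1): it raises k by at most e/2, and the other e/2 is the slack. The + 1 covers k
   = 0. *)
pose T := 1 + e / 2 / (k + 1).
have k1 : 0 < k + 1 by rewrite ltr_wpDl.
have e2 : 0 < e / 2 by rewrite divr_gt0.
have T1 : 1 < T by rewrite ltrDl divr_gt0.
have q21 : 0 < 2 * q + 1 by rewrite addr_gt0// mulr_gt0.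
pose t := T `^ (2 * q + 1)^-1.
have tT : t `^ (2 * q + 1) = T.
  by rewrite /t -powRrM mulVf ?gt_eqF// powRr1// (le_trans _ (ltW T1)).
have t1 : 1 < t.
  have h : 1 `^ (2 * q + 1)^-1 = 1 :> R by rewrite powR1.
  rewrite -[ltLHS]h /t; apply: gt0_ltr_powR;
    by rewrite ?invr_gt0 ?nnegrE// (le_trans _ (ltW T1)).
apply: (le_trans (modulus_slack t1 e2 Koo HL2)).
rewrite tT -(fineK Kfin) -/k -EFinM -!EFinD lee_fin.
have : e / 2 / (k + 1) * k <= e / 2.
  by rewrite mulrAC ler_pdivrMr// ler_pM2l// lerDl.
rewrite /T mulrDl mul1r; lra.
Qed.

End main.

Theorem theorem2p2 (R : realType) (n : nat) (D : set 'rV[R]_n)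
    (f : 'rV[R]_n -> 'rV[R]_n) (q : R) :
  (2 <= n)%N -> domain D -> 1 <= q ->
  {within D, continuous f} ->
  diff_ae D f -> N_prop D f -> Ninv_prop D f -> L2_prop q D f ->
  forall (G : set (curve R n)) (rho : 'rV[R]_n -> \bar R),
    (forall g, G g -> curve_in D g) ->
    adm G rho ->
    (modulus q (fam_image f G) <=
       mint D (fun x => KIq q f x * (rho x `^ q)))%E.
Proof.
(* The results above are stated in dimension [m.+1]; dimension 0 is excluded by [2 <= n]. *)
case: n D f => [|m] D f // _ [oD _] q1 contf fdiff fN fNinv HL2 G rho GD admrho.
apply: modulus_le => //.
exact: within_open_continuous.
Qed.
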